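(* Let $s:(0,1/2)\times(0,1)\to(0,\infty)$ be given by $$s(\varepsilon,\delta)=\min\left\{\delta^2,\ \varepsilon\delta^{3/2}\left(\left|\ln\left(\frac{\varepsilon}{\delta^{1/2}}\right)\right|+1\right),\ \varepsilon\delta^{1/2}\right\}.$$ With $E_{\varepsilon,\delta}$ and $\mathcal{S}_0(\Omega,\varepsilon)$ as in the context, the following hold. (i) There is a constant $C>0$ such that for all $(\varepsilon,\delta)\in(0,1/2)\times(0,1)$, $$\min\{E_{\varepsilon,\delta}(u,\Omega):u\in\mathcal{S}_0(\Omega,\varepsilon)\}\le C\,s(\varepsilon,\delta).$$ (ii) There are $\overline\delta\in(0,1)$ and a constant $c>0$, depending only on $\overline\delta$, such that for all $(\varepsilon,\delta)\in(0,1/2)\times[\overline\delta,1)$, $$c\,\varepsilon\delta^{1/2}\le\min\{E_{\varepsilon,\delta}(u,\Omega):u\in\mathcal{S}_0(\Omega,\varepsilon)\},$$ and for all $\delta\in(0,\overline\delta)$ and $\varepsilon\in[\delta,1/2)$, $$c\,\min\left\{\delta^2,\ \varepsilon\delta^{3/2}\left(\left|\ln\left(\frac{\varepsilon}{\delta^{1/2}}\right)\right|+1\right)\right\}\le\min\{E_{\varepsilon,\delta}(u,\Omega):u\in\mathcal{S}_0(\Omega,\varepsilon)\}.$$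
   Context: Let $\Omega=[0,1)^2$, $\varepsilon\in(0,1/2)$, $\delta\in(0,1)$. Put $\mathcal{I}=\{(i,j)\in\mathbb{Z}^2:(i\varepsilon,j\varepsilon)\in\Omega\}$, $\mathcal{I}_{NN}^{hor}=\{(i,j)\in\mathcal{I}:(i+2,j)\in\mathcal{I}\}$, $\mathcal{I}_{NN}^{ver}=\{(i,j)\in\mathcal{I}:(i,j+2)\in\mathcal{I}\}$. A spin field is a map $u:\Omega\cap\varepsilon\mathbb{Z}^2\to\mathbb{S}^1\subset\mathbb{R}^2$, $u_{i,j}=u(i\varepsilon,j\varepsilon)$. Its energy is $$E_{\varepsilon,\delta}(u,\Omega)=\frac{\varepsilon^2}{2}\sum_{(i,j)\in\mathcal{I}_{NN}^{hor}}|u_{i,j}-2(1-\delta)u_{i+1,j}+u_{i+2,j}|^2+\frac{\varepsilon^2}{2}\sum_{(i,j)\in\mathcal{I}_{NN}^{ver}}|u_{i,j}-2(1-\delta)u_{i,j+1}+u_{i,j+2}|^2.$$ $\mathcal{S}_0(\Omega,\varepsilon)$ is the set of spin fields $u:\Omega\cap\varepsilon\mathbb{Z}^2\to\mathbb{S}^1$ with $u_{0,j}=(0,1)^T$ for all $j$ with $(0,j)\in\mathcal{I}$. *)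

(* Defs.v *)
From HB Require Import structures.
From mathcomp Require Import all_boot all_order all_algebra.
From mathcomp Require Import all_classical all_reals all_analysis.

Set Implicit Arguments.
Unset Strict Implicit.
Unset Printing Implicit Defensive.

Import Order.TTheory GRing.Theory Num.Theory.
Import numFieldNormedType.Exports.

Local Open Scope classical_set_scope.
Local Open Scope ring_scope.

Section Defs.
Variable R : realType.
Implicit Types (eps delta : R) (u : R * R -> 'cV[R]_2).

(* The library norm on matrices is the sup norm, hence this one. *)
Definition enorm (v : 'cV[R]_2) : R := Num.sqrt (\sum_i v i 0 ^+ 2).

Definition circle : set 'cV[R]_2 := [set v | enorm v = 1].

Definition e2 : 'cV[R]_2 := delta_mx 1 0.

Definition Omega : set (R * R) := `[0, 1[ `*` `[0, 1[.

Definition node eps (i j : int) : R * R := (i%:~R * eps, j%:~R * eps).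

Definition lattice eps : set (R * R) :=
  Omega `&` [set x | exists i j : int, x = node eps i j].

Definition idx eps : set (int * int) := [set p | Omega (node eps p.1 p.2)].

Definition idx_hor eps : set (int * int) :=
  [set p | idx eps p /\ idx eps (p.1 + 2, p.2)].

Definition idx_ver eps : set (int * int) :=
  [set p | idx eps p /\ idx eps (p.1, p.2 + 2)].

(* A finitely supported sum [\sum_(p \in A)] is 0 by convention when the
   support is infinite; this lemma shows that the convention plays no role
   in [energy] below. *)
Lemma finite_idx eps : 0 < eps -> finite_set (idx eps).
Proof.
move=> eps0; set N := (Num.truncn eps^-1).+1.
have itv (i : int) : 0 <= i%:~R * eps < 1 -> exists2 n, (n < N)%N & i = n%:Z.
  rewrite pmulr_lge0// ler0z => /andP[].
  case: i => // n _; rewrite -ltr_pdivlMr// div1r => ni.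
  exists n => //; rewrite -(ltr_nat R).
  exact: lt_trans ni (truncnS_gt _).
apply: (@sub_finite_set _ _
  ((fun p : nat * nat => (p.1%:Z, p.2%:Z)) @` (`I_N `*` `I_N))).
  move=> [i j] [/=]; rewrite !in_itv/= => /itv[m mN ->] /itv[n nN ->].
  by exists (m, n).
by apply: finite_image; apply: finite_setX; apply: finite_II.
Qed.

(* A spin field on [lattice eps] is represented by a total function that maps
   the lattice into the circle; its values off the lattice are irrelevant. *)
Definition spin_field eps u : Prop := set_fun (lattice eps) circle u.

Definition energy eps delta u : R :=
  let U i j := u (node eps i j) in
  eps ^+ 2 / 2 * (\sum_(p \in idx_hor eps)
     enorm (U p.1 p.2 - (2 * (1 - delta)) *: U (p.1 + 1) p.2
            + U (p.1 + 2) p.2) ^+ 2)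
  + eps ^+ 2 / 2 * (\sum_(p \in idx_ver eps)
     enorm (U p.1 p.2 - (2 * (1 - delta)) *: U p.1 (p.2 + 1)
            + U p.1 (p.2 + 2)) ^+ 2).

Definition S0 eps : set (R * R -> 'cV[R]_2) :=
  [set u | spin_field eps u /\
           forall j : int, idx eps (0, j) -> u (node eps 0 j) = e2].

Definition is_min (A : set R) (m : R) : Prop := A m /\ lbound A m.

Definition is_min_energy eps delta (m : R) : Prop :=
  is_min [set energy eps delta u | u in S0 eps] m.

Definition log_scaling eps delta : R :=
  eps * delta `^ (3 / 2) * (`|ln (eps / delta `^ (1 / 2))| + 1).

Definition s eps delta : R :=
  Num.min (delta ^+ 2)
    (Num.min (log_scaling eps delta) (eps * delta `^ (1 / 2))).

Lemma s_gt0 eps delta : 0 < eps -> 0 < delta -> 0 < s eps delta.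
Proof.
move=> e0 d0; have p0 a : 0 < delta `^ a by exact: powR_gt0.
by rewrite !lt_min exprn_gt0// !mulr_gt0// ltr_wpDl.
Qed.

End Defs.

(* Main.v *)
Require Import Defs.
From mathcomp Require Import all_boot all_order all_algebra.
From mathcomp Require Import all_classical all_reals all_analysis.
From mathcomp Require Import ring lra zify.
Set Implicit Arguments.
Unset Strict Implicit.
Unset Printing Implicit Defensive.
Import Order.TTheory GRing.Theory Num.Theory.
Import numFieldNormedType.Exports.
Local Open Scope classical_set_scope.
Local Open Scope ring_scope.

(* On the N x N grid (N about 1/eps) write r for sqrt delta. A triple costs
   nothing exactly when both angle increments equal th or both equal -th, where
   cos th = 1 - delta, so th is of order r; the boundary column forces the
   vertical increments there to vanish.

   Lower bound. If delta is bounded below, the boundary column alone is costly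
   enough. Otherwise, either some triple is far from aligned, and then a
   single term already costs of order eps^2 >= delta^2, or all increments are
   small and the spin field lifts to an angle phi, with phi = 0 on that column. A row on
   which |phi| exceeds 6 r i at column i is expensive (Cauchy-Schwarz). A block
   of rows of column i without transition has |phi| growing at rate r / 2, so a
   block of 40 i rows contains either a transition, of cost r^3, or 5 i
   expensive rows. Summing over the blocks of column i, and then over the scales
   1 / r <= i <= N / 40, yields N r^3 times a harmonic sum, hence the logarithm.

   Upper bound. Besides the constant field there are two competitors. Iterated
   folding of a zigzag gives an integer profile with slopes +-1 in both
   directions, with kinks of total length O(N) per dyadic layer, vanishing at the
   boundary; averaging it over windows of size 1 / r costs O(delta^2) per point
   near the kinks and nothing elsewhere. For exponentially small eps it is
   cheaper to interpolate between the constant and the helix within 1 / r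
   columns, at the price of O(N r) vortices of bounded cost each. *)

(** * Reduction to a finite grid *)

Section Grid.
Variable R : realType.
Implicit Types (eps delta : R) (N : nat) (v : nat -> nat -> R * R).

Definition dens delta (x y z : R * R) : R :=
  (x.1 - 2 * (1 - delta) * y.1 + z.1) ^+ 2
  + (x.2 - 2 * (1 - delta) * y.2 + z.2) ^+ 2.

Definition grid_energy N delta v : R :=
  \sum_(0 <= j < N) \sum_(0 <= i < N.-2)
     dens delta (v i j) (v i.+1 j) (v i.+2 j)
  + \sum_(0 <= i < N) \sum_(0 <= j < N.-2)
     dens delta (v i j) (v i j.+1) (v i j.+2).

Definition unit_vec (x : R * R) : Prop := x.1 ^+ 2 + x.2 ^+ 2 = 1.

Definition admissible v :=
  (forall i j, unit_vec (v i j)) /\ (forall j, v 0%N j = (1, 0)).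

Lemma dens_ge0 delta x y z : 0 <= dens delta x y z.
Proof. by rewrite addr_ge0// sqr_ge0. Qed.

(** [N] is the least integer with [1 <= N * eps], that is, the number of nodes per row; minimality
    gives [N * eps < 1 + eps], whence the bound [3 / 2]. *)
Lemma grid_size eps : 0 < eps < 1 / 2 -> exists N : nat,
  [/\ forall n : nat, (n%:R * eps < 1) = (n < N)%N, (2 < N)%N,
      1 <= N%:R * eps & N%:R * eps <= 3 / 2].
Proof.
move=> /andP[e0 e2].
have ex : exists n : nat, 1 <= n%:R * eps.
  exists (Num.truncn eps^-1).+1; rewrite -ler_pdivrMr// div1r ltW//.
  exact: truncnS_gt.
pose N := ex_minn ex; exists N; rewrite /N; case: ex_minnP => {N} N N1 minN.
have lt_N n : (n%:R * eps < 1) = (n < N)%N.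
  apply/idP/idP => [h|nN].
    rewrite ltnNge; apply/negP => Nn; move: h; rewrite ltNge => /negP; apply.
    by rewrite (le_trans N1)// ler_pM2r// ler_nat.
  by rewrite ltNge; apply/negP => /minN; rewrite leqNgt nN.
have N2 : (2 < N)%N by rewrite -lt_N; lra.
split => //; have : N.-1%:R * eps < 1 by rewrite lt_N prednK// (ltn_trans _ N2).
have -> : (N%:R : R) = N.-1%:R + 1 by rewrite natr1 prednK// (ltn_trans _ N2).
by move=> ?; lra.
Qed.

(** Swapping the coordinates sends [e2] to [(1, 0)], the direction of angle 0, and preserves
    lengths. *)
Definition comp (w : 'cV[R]_2) : R * R := (w 1 0, w 0 0).

Lemma enorm_sqr (w : 'cV[R]_2) : enorm w ^+ 2 = w 0 0 ^+ 2 + w 1 0 ^+ 2.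
Proof.
rewrite /enorm sqr_sqrtr; last by apply: sumr_ge0 => i _; exact: sqr_ge0.
by rewrite big_ord_recl big_ord1; congr (_ + w _ _ ^+ 2); apply/val_inj.
Qed.

Lemma dens_comp delta (x y z : 'cV[R]_2) :
  enorm (x - (2 * (1 - delta)) *: y + z) ^+ 2
  = dens delta (comp x) (comp y) (comp z).
Proof. by rewrite enorm_sqr !mxE /dens /comp [LHS]addrC. Qed.

Lemma circleP (w : 'cV[R]_2) : circle w <-> unit_vec (comp w).
Proof.
rewrite /circle /unit_vec /= [_ + _]addrC -enorm_sqr; split => [->|h].
  by rewrite expr1n.
by apply/eqP; rewrite -(@pexpr_eq1 _ _ 2)// ?h//; exact: sqrtr_ge0.
Qed.

Lemma comp_inj : injective comp.
Proof.
move=> x y [h1 h0]; apply/matrixP => i j; rewrite ord1.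
by case: i => -[|[|//]] ilt; [move: h0|move: h1]; congr (x _ _ = y _ _); apply/val_inj.
Qed.

Lemma idxE eps N (p : int * int) : 0 < eps ->
  (forall n : nat, (n%:R * eps < 1) = (n < N)%N) ->
  idx eps p <-> exists m n : nat, [/\ p = (m%:Z, n%:Z), (m < N)%N & (n < N)%N].
Proof.
move=> e0 NP; case: p => i j.
have one (k : int) :
    0 <= k%:~R * eps < 1 <-> exists2 m : nat, k = m%:Z & (m < N)%N.
  split => [|[m -> mN]]; last by rewrite NP mN andbT mulr_ge0// ltW.
  rewrite pmulr_lge0// ler0z => /andP[].
  by case: k => // m _; rewrite NP; exists m.
split.
- move=> [/=]; rewrite !in_itv/= => /one[m -> mN] /one[n -> nN].
  by exists m, n.
- move=> [m [n [[-> ->] mN nN]]]; split; rewrite /= in_itv/=.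
    by apply/one; exists m.
  by apply/one; exists n.
Qed.

Lemma fsbig_grid (M N : nat) (A : set (int * int)) (F : int * int -> R) :
  (forall p, A p <->
     exists m n : nat, [/\ p = (m%:Z, n%:Z), (m < M)%N & (n < N)%N]) ->
  \sum_(p \in A) F p = \sum_(0 <= i < M) \sum_(0 <= j < N) F (i%:Z, j%:Z).
Proof.
move=> AP.
have -> : A = (fun p : nat * nat => (p.1%:Z, p.2%:Z)) @` (`I_M `*` `I_N).
  apply/seteqP; split => p.
    by move=> /AP[m [n [-> mM nN]]]; exists (m, n).
  by move=> [[m n] [/= mM nN] <-]; apply/AP; exists m, n.
rewrite fsbig_image; last by move=> [? ?] [? ?] _ _ [-> ->].
rewrite -(pair_fsbig _ (fun m n : nat => F (m%:Z, n%:Z)))//.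
rewrite -fsbig_ord big_mkord; apply: eq_bigr => i _.
by rewrite -fsbig_ord big_mkord.
Qed.

Lemma energy_grid eps delta N u v : 0 < eps -> (2 < N)%N ->
  (forall n : nat, (n%:R * eps < 1) = (n < N)%N) ->
  (forall i j : nat, (i < N)%N -> (j < N)%N ->
     comp (u (node eps i%:Z j%:Z)) = v i j) ->
  energy eps delta u = eps ^+ 2 / 2 * grid_energy N delta v.
Proof.
move=> e0 N2 NP uv; rewrite /energy /grid_energy -mulrDr; congr (_ * _).
have lt2 m : (m < N.-2)%N = (m.+2 < N)%N.
  by rewrite -[in RHS](ltn_predK N2) ltnS -ltn_predRL.
have IDX p := idxE p e0 NP.
have P1 (m : nat) : m%:Z + 1 = m.+1%:Z by rewrite -[m.+1]addn1 PoszD.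
have P2 (m : nat) : m%:Z + 2 = m.+2%:Z by rewrite -[m.+2]addn2 PoszD.
have idx2 (p : int * int) : idx_hor eps p <->
    exists m n : nat, [/\ p = (m%:Z, n%:Z), (m < N.-2)%N & (n < N)%N].
  split.
    move=> [/IDX[m [n [-> mN nN]]]].
    move=> /IDX[m' [n' [[hm hn] mN' nN']]].
    exists m, n; split => //; rewrite lt2; move: mN'.
    by rewrite -hm addnA !addn1.
  move=> [m [n [-> mN nN]]]; rewrite lt2 in mN; split; apply/IDX.
    by exists m, n; split => //; apply: ltn_trans mN.
  by exists m.+2, n; split => //; rewrite -P2.
have idy2 (p : int * int) : idx_ver eps p <->
    exists m n : nat, [/\ p = (m%:Z, n%:Z), (m < N)%N & (n < N.-2)%N].
  split.
    move=> [/IDX[m [n [-> mN nN]]]].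
    move=> /IDX[m' [n' [[hm hn] mN' nN']]].
    exists m, n; split => //; rewrite lt2; move: nN'.
    by rewrite -hn addnA !addn1.
  move=> [m [n [-> mN nN]]]; rewrite lt2 in nN; split; apply/IDX.
    by exists m, n; split => //; apply: ltn_trans nN.
  by exists m, n.+2; split => //; rewrite -P2.
rewrite (fsbig_grid _ idx2) (fsbig_grid _ idy2) exchange_big_nat/=.
congr (_ + _).
  apply: eq_big_nat => j /andP[_ jN]; apply: eq_big_nat => i /andP[_].
  rewrite lt2 => iN; rewrite dens_comp !P1 !P2 !uv//.
    by apply: ltn_trans iN.
  by apply: ltn_trans iN.
apply: eq_big_nat => i /andP[_ iN]; apply: eq_big_nat => j /andP[_].
rewrite lt2 => jN; rewrite dens_comp !P1 !P2 !uv//.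
  by apply: ltn_trans jN.
by apply: ltn_trans jN.
Qed.

Lemma circle_compact : compact [set x : R * R | unit_vec x].
Proof.
have sub : [set x : R * R | unit_vec x] `<=` `[-1, 1] `*` `[-1, 1].
  move=> [a b] /=; rewrite /unit_vec !in_itv/= => h.
  by split; apply/andP; split; nra.
apply: subclosed_compact sub; last first.
  by apply: compact_setX; exact: segment_compact.
have -> : [set x : R * R | unit_vec x] =
    (fun x : R * R => x.1 ^+ 2 + x.2 ^+ 2) @^-1` [set y | y = 1] by [].
apply: (@closed_comp (R * R)%type R); last exact: closed_eq.
move=> x _; by apply: cvgD; apply: cvgM; (exact: cvg_fst || exact: cvg_snd).
Qed.

(** By Tychonoff the admissible fields on [nat * nat] form a compact set, the boundary condition
    being a choice of singleton factors. The energy involves finitely many sites, so it is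
    continuous for the product topology. *)
Lemma grid_energy_min N delta : exists2 v, admissible v &
  forall v', admissible v' -> grid_energy N delta v <= grid_energy N delta v'.
Proof.
pose A (p : nat * nat) : set (R * R) :=
  if p.1 == 0%N then [set (1, 0)] else [set x | unit_vec x].
pose T := prod_topology (fun _ : nat * nat => (R * R)%type).
pose f (g : T) : R := grid_energy N delta (fun i j => g (i, j)).
have cA : @compact T [set g | forall p, A p (g p)].
  apply: tychonoff => p; rewrite /A; case: ifP => _; first exact: compact_set1.
  exact: circle_compact.
have sumc (n : nat) (F : nat -> T -> R) : (forall k, continuous (F k)) ->
    continuous (fun g => \sum_(0 <= k < n) F k g).
  move=> Fc; elim: n => [|n IH].
    have -> : (fun g : T => \sum_(0 <= k < 0) F k g) = cst 0.
      by apply/funext => g; rewrite big_geq.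
    exact: cst_continuous.
  have -> : (fun g : T => \sum_(0 <= k < n.+1) F k g) =
      (fun g => \sum_(0 <= k < n) F k g + F n g).
    by apply/funext => g; rewrite big_nat_recr.
  move=> x; apply: (@continuousD R R T _ _ x); [exact: IH|exact: Fc].
have densc (p q r : nat * nat) :
    continuous (fun g : T => dens delta (g p) (g q) (g r)).
  have pc (p0 : nat * nat) : continuous (fun g : T => (g p0).1) /\
      continuous (fun g : T => (g p0).2).
    split => g; (apply: (@cvg_comp _ _ _ (fun g : T => g p0) _ _ (nbhs (g p0)));
      [exact: (@proj_continuous _ (fun _ => (R * R)%type) p0)|]).
      exact: cvg_fst.
    exact: cvg_snd.
  have lin (a b c : T -> R) : continuous a -> continuous b -> continuous c ->
      continuous (fun g => (a g - 2 * (1 - delta) * b g + c g) ^+ 2).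
    move=> ac bc cc g.
    have h : {for g, continuous (fun g => a g - 2 * (1 - delta) * b g + c g)}.
      apply: (@continuousD R R T _ _ g); last exact: cc.
      apply: (@continuousB R R T _ _ g); first exact: ac.
      by apply: (@continuousM R T _ _ g); [exact: cst_continuous|exact: bc].
    exact: (@continuousM R T _ _ g).
  have [pc1 pc2] := pc p; have [qc1 qc2] := pc q; have [rc1 rc2] := pc r.
  by move=> g; apply: (@continuousD R R T _ _ g); exact: lin.
have fc : continuous f.
  by move=> g; apply: (@continuousD R R T _ _ g); do 2 (apply: (sumc) => ?); exact: densc.
have ne : [set g : T | forall p, A p (g p)] !=set0.
  exists (fun=> (1, 0)) => p; rewrite /A; case: ifP => //= _.
  by rewrite /unit_vec expr1n expr0n addr0.
have [g gA gmin] := compact_EVT_min ne cA (continuous_subspaceT fc).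
rewrite inE in gA; exists (fun i j => g (i, j)).
  split => [i j|j]; last exact: (gA (0%N, j)).
  have := gA (i, j); rewrite /A; case: ifP => //= _ ->.
  by rewrite /unit_vec expr1n expr0n addr0.
move=> v' [v'1 v'0]; apply: (gmin (fun p => v' p.1 p.2)).
by rewrite inE => -[i j]; rewrite /A/=; case: eqP => [->|_]; [exact: v'0|exact: v'1].
Qed.

Lemma min_energy_grid eps delta N : 0 < eps -> (2 < N)%N ->
  (forall n : nat, (n%:R * eps < 1) = (n < N)%N) ->
  exists2 v, admissible v &
    is_min_energy eps delta (eps ^+ 2 / 2 * grid_energy N delta v) /\
    forall v', admissible v' -> grid_energy N delta v <= grid_energy N delta v'.
Proof.
move=> e0 N2 NP; have [v va vmin] := grid_energy_min N delta.
exists v => //; split => //.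
(* The indices of a node are recovered by truncating [x / eps]; off the lattice [u] still takes unit
   values. *)
pose u (x : R * R) : 'cV[R]_2 :=
  let w := v (Num.truncn (x.1 / eps)) (Num.truncn (x.2 / eps)) in
  \col_i (if i == 0 then w.2 else w.1).
have uE (i j : nat) : comp (u (node eps i%:Z j%:Z)) = v i j.
  rewrite /u /node /comp !mxE /= !mulfK ?gt_eqF// !natrK.
  by case: (v i j).
have NP' p := idxE p e0 NP.
split; last first.
  move=> _ [u' [sf bc] <-].
  (* [admissible] ranges over all indices, hence the default value [(1, 0)] outside the grid. *)
  pose v' (i j : nat) : R * R := if (i < N)%N && (j < N)%N
    then comp (u' (node eps i%:Z j%:Z)) else (1, 0).
  have -> : energy eps delta u' = eps ^+ 2 / 2 * grid_energy N delta v'.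
    by apply: energy_grid => // i j iN jN; rewrite /v' iN jN.
  apply: ler_wpM2l; first by rewrite divr_ge0// sqr_ge0.
  apply: vmin; split => [i j|j]; rewrite /v'; last first.
    case: ifP => // /andP[N0 jN]; rewrite bc; last by apply/NP'; exists 0%N, j.
    by rewrite /comp /e2 !mxE.
  case: ifP => [/andP[iN jN]|_]; last by rewrite /unit_vec expr1n expr0n addr0.
  apply/circleP/sf; split; last by exists i%:Z, j%:Z.
  by have /NP' : exists m n : nat, [/\ (i%:Z, j%:Z) = (m%:Z, n%:Z), (m < N)%N & (n < N)%N]
    by exists i, j.
exists u; last by apply: energy_grid.
split => [x _|j jidx]; first by apply/circleP; rewrite /comp !mxE; exact: va.1.
apply: comp_inj; have /NP'[m [n [[m0 ->] _ _]]] := jidx.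
by rewrite (uE 0%N n) va.2 /comp /e2 !mxE.
Qed.

End Grid.

(** * Angles and sums *)

Section Trig.
Variable R : realType.
Implicit Types (x y z q : R).

Definition expi x : R * R := (cos x, sin x).

Lemma unit_vec_expi x : unit_vec (expi x).
Proof. exact: cos2Dsin2. Qed.

(** A rotation by [- y] brings the middle vector to [(1, 0)]; the two squares are the components of
    the residual along and across it, and depend on the increments only. *)
Lemma dens_expi delta x y z : dens delta (expi x) (expi y) (expi z) =
  (cos (y - x) + cos (z - y) - 2 * (1 - delta)) ^+ 2
  + (sin (z - y) - sin (y - x)) ^+ 2.
Proof.
have cx : cos x = cos y * cos (y - x) + sin y * sin (y - x).
  by rewrite -cosB; congr cos; ring.
have sx : sin x = sin y * cos (y - x) - cos y * sin (y - x).
  by rewrite -sinB; congr sin; ring.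
have cz : cos z = cos y * cos (z - y) - sin y * sin (z - y).
  by rewrite -cosD; congr cos; ring.
have sz : sin z = sin y * cos (z - y) + cos y * sin (z - y).
  by rewrite -sinD; congr sin; ring.
rewrite /dens/= cx sx cz sz.
set a := cos (y - x); set b := sin (y - x).
set c := cos (z - y); set d := sin (z - y).
transitivity ((cos y ^+ 2 + sin y ^+ 2) *
  ((a + c - 2 * (1 - delta)) ^+ 2 + (d - b) ^+ 2)); first by ring.
by rewrite cos2Dsin2 mul1r.
Qed.

Lemma sin_sub_le x y : x <= y -> `|sin y - sin x| <= y - x.
Proof.
rewrite le_eqVlt => /predU1P[->|xy]; first by rewrite !subrr normr0.
have [c _ ->] := MVT xy (fun t _ => is_derive_sin t)
  (continuous_subspaceT (@continuous_sin R)).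
rewrite normrM (gtr0_norm (_ : 0 < y - x)) ?subr_gt0//.
rewrite ler_piMl ?subr_ge0 ?(ltW xy)//.
by rewrite ler_norml cos_geN1 cos_le1.
Qed.

Lemma sin_ge_mul_cos y : 0 <= y <= pi / 2 -> y * cos y <= sin y.
Proof.
move=> /andP[]; rewrite le_eqVlt => /predU1P[<- _|y0 ypi].
  by rewrite mul0r sin0.
have [c] := MVT y0 (fun t _ => is_derive_sin t)
  (continuous_subspaceT (@continuous_sin R)).
rewrite in_itv/= sin0 !subr0 => /andP[c0 cy] ->.
rewrite mulrC ler_pM2r// ltW// ltr_cos// in_itv/=.
  by have := pi_gt0 R; lra.
by have := pi_gt0 R; lra.
Qed.

(** By the half-angle formula and [sin_ge_mul_cos] at [y / 2], [sin y] is at least [y * cos (y / 2)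
    ^ 2 = y * (1 + cos y) / 2]. *)
Lemma sin_ge_half y : 0 <= y <= pi / 2 -> y / 2 <= sin y.
Proof.
move=> /andP[y0 ypi]; have p0 := pi_gt0 R.
have h : y / 2 * cos (y / 2) <= sin (y / 2) by apply: sin_ge_mul_cos; lra.
have c0 : 0 <= cos (y / 2) by apply: cos_ge0_pihalf; lra.
have cy : 0 <= cos y by apply: cos_ge0_pihalf; lra.
have e : y = y / 2 + y / 2 by lra.
have sE : sin y = 2 * (sin (y / 2) * cos (y / 2)).
  by rewrite {1}e sinD; ring.
have cE : cos y = 2 * cos (y / 2) ^+ 2 - 1.
  by rewrite {1}e cosD -!expr2 sin2cos2; ring.
have : y / 2 * cos (y / 2) * cos (y / 2) <= sin (y / 2) * cos (y / 2).
  exact: ler_wpM2r.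
nra.
Qed.

Lemma abs_le_sin q : `|q| <= pi / 2 -> `|q| <= 2 * `|sin q|.
Proof.
move=> qpi; have [q0|q0] := leP 0 q.
  rewrite (ger0_norm q0) in qpi *.
  have := @sin_ge_half q; rewrite q0 qpi => /(_ isT) h.
  by have := ler_norm (sin q); lra.
rewrite (ltr0_norm q0) in qpi *.
have := @sin_ge_half (- q); rewrite qpi oppr_ge0 (ltW q0) sinN => /(_ isT) h.
by have := ler_norm (- sin q); rewrite normrN; lra.
Qed.

(** [sin q ^ 2 = (1 - cos q) * (1 + cos q)], and the second factor is at least 1. *)
Lemma one_sub_cos_le q : `|q| <= pi / 2 -> 1 - cos q <= sin q ^+ 2.
Proof.
rewrite ler_norml => h; have c0 := cos_ge0_pihalf h.
by have := cos_le1 q; have := cos2Dsin2 q; nra.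
Qed.

Lemma one_sub_cos_ge q : `|q| <= pi / 2 -> q ^+ 2 / 8 <= 1 - cos q.
Proof.
move=> h; have := abs_le_sin h.
have : sin q ^+ 2 <= 2 * (1 - cos q).
  by have := cos_le1 q; have := cos_geN1 q; have := cos2Dsin2 q; nra.
rewrite -[sin q ^+ 2]real_normK ?num_real// -[q ^+ 2]real_normK ?num_real//.
by have := normr_ge0 q; nra.
Qed.

(** The form of Cauchy-Schwarz used throughout: for a nonnegative sum, expand the sum of the squares
    [(x k - c) ^ 2]. *)
Lemma sum_sqr_ge (n : nat) (x : nat -> R) (c : R) :
  0 <= c -> n%:R * c <= `|\sum_(0 <= k < n) x k| ->
  n%:R * c ^+ 2 <= \sum_(0 <= k < n) x k ^+ 2.
Proof.
move=> c0; wlog : x / 0 <= \sum_(0 <= k < n) x k => [wh|s0].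
  have [s0|s0] := leP 0 (\sum_(0 <= k < n) x k); first exact: wh.
  rewrite -normrN -sumrN => /(wh (fun k => - x k)).
  rewrite sumrN oppr_ge0 (ltW s0) => /(_ isT).
  by under eq_bigr do rewrite sqrrN.
rewrite ger0_norm// => h.
have : 0 <= \sum_(0 <= k < n) (x k - c) ^+ 2.
  by apply: sumr_ge0 => *; exact: sqr_ge0.
have -> : \sum_(0 <= k < n) (x k - c) ^+ 2
    = \sum_(0 <= k < n) x k ^+ 2 - 2 * c * \sum_(0 <= k < n) x k + n%:R * c ^+ 2.
  have -> : n%:R * c ^+ 2 = \sum_(0 <= k < n) c ^+ 2.
    by rewrite sumr_const_nat subn0 mulr_natl.
  rewrite mulr_sumr -sumrB -big_split/=.
  by apply: eq_bigr => k _; ring.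
nra.
Qed.

Lemma sum_nat_sub_le (F : nat -> R) (a l n : nat) : (forall k, 0 <= F k) ->
  (a + l <= n)%N -> \sum_(0 <= k < l) F (a + k)%N <= \sum_(0 <= k < n) F k.
Proof.
move=> F0 aln.
have an : (a <= n)%N := leq_trans (leq_addr l a) aln.
rewrite (@big_cat_nat _ _ _ a 0%N n)//= (@big_cat_nat _ _ _ (a + l)%N a n)//=;
  last exact: leq_addr.
have -> : \sum_(a <= k < a + l) F k = \sum_(0 <= k < l) F (a + k)%N.
  rewrite -[X in \sum_(X <= _ < _) _]add0n big_addn addKn; apply: eq_bigr => k _.
  by rewrite addnC.
rewrite addrCA lerDl addr_ge0//; apply: sumr_ge0 => *; exact: F0.
Qed.

End Trig.

(** * Chains of angles *)

Section Chain.
Variable R : realType.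
Variables (r : R) (f : nat -> R).
Hypothesis r0 : 0 < r.
Let d k := f k.+1 - f k.
Let t k := dens (r ^+ 2) (expi (f k)) (expi (f k.+1)) (expi (f k.+2)).

Let tE k : t k = (cos (d k) + cos (d k.+1) - 2 * (1 - r ^+ 2)) ^+ 2
  + (sin (d k.+1) - sin (d k)) ^+ 2.
Proof. exact: dens_expi. Qed.

Let t_ge0 k : 0 <= t k. Proof. exact: dens_ge0. Qed.

(** The increments have mean square at least [36 * r ^ 2], so [1 - cos (d k)] has mean at least
    [9 / 2 * r ^ 2]. A free triple would have its two such terms add up to [2 * r ^ 2]; the mean
    excess is at least [2 * r ^ 2], and Cauchy-Schwarz applies a second time. *)
Lemma chain_drift (i : nat) : f 0%N = 0 ->
  (forall k, (k <= i)%N -> `|d k| <= pi / 2) ->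
  6 * r * i%:R < `|f i| -> 4 * r ^+ 4 * i%:R <= \sum_(0 <= k < i) t k.
Proof.
move=> f0 dpi drift.
have sd : \sum_(0 <= k < i) d k = f i.
  by rewrite telescope_sumr// f0 subr0.
have d2 : i%:R * (6 * r) ^+ 2 <= \sum_(0 <= k < i) d k ^+ 2.
  apply: sum_sqr_ge; [by rewrite mulr_ge0// ltW|by rewrite sd mulrC ltW].
(* The component of the residual along the middle vector; the other one is dropped. *)
pose g k := 2 * r ^+ 2 - (1 - cos (d k)) - (1 - cos (d k.+1)).
have tg k : g k ^+ 2 <= t k.
  rewrite tE (_ : _ - _ = g k); last by rewrite /g; ring.
  by rewrite lerDl sqr_ge0.
apply: le_trans (ler_sum _ (fun k _ => tg k)).
have -> : 4 * r ^+ 4 * i%:R = i%:R * (2 * r ^+ 2) ^+ 2 by ring.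
apply: sum_sqr_ge; first by rewrite mulr_ge0// sqr_ge0.
rewrite -normrN; apply: le_trans (ler_norm _); rewrite -sumrN.
have gk k : (k < i)%N -> d k ^+ 2 / 8 - 2 * r ^+ 2 <= - g k.
  move=> ki; have := one_sub_cos_ge (dpi _ (ltnW ki)).
  by have := cos_le1 (d k.+1); rewrite /g; lra.
apply: (@le_trans _ _ (\sum_(0 <= k < i) (d k ^+ 2 / 8 - 2 * r ^+ 2))); last first.
  by rewrite !big_nat; apply: ler_sum => k /andP[_ ki]; exact: gk.
rewrite sumrB -mulr_suml sumr_const_nat subn0 -mulr_natl.
have : 0 <= i%:R * r ^+ 2 by rewrite mulr_ge0// sqr_ge0.
lra.
Qed.

Let s k := sin (d k).

(** By Cauchy-Schwarz a change of the sine by [r / 4] within [l] steps costs at least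
    [r ^ 2 / (16 * l)], which is at least [m * r ^ 4 / 16] because [l * r] and [m * r] are at most
    1. *)
Lemma chain_osc (n m j l : nat) : (0 < l <= m)%N -> (j + l < n)%N ->
  m%:R * r <= 1 -> \sum_(0 <= k < n.-1) t k < m%:R * r ^+ 4 / 16 ->
  `|s (j + l) - s j| <= r / 4.
Proof.
move=> /andP[l0 lm] jln mr small; rewrite leNgt; apply/negP => big.
have l0' : 0 < l%:R :> R by rewrite ltr0n.
have : l%:R * (r / (4 * l%:R)) ^+ 2
    <= \sum_(0 <= k < l) (s (j + k).+1 - s (j + k)) ^+ 2.
  apply: sum_sqr_ge; first by rewrite divr_ge0 ?mulr_ge0// ltW.
  have -> : \sum_(0 <= k < l) (s (j + k).+1 - s (j + k)) = s (j + l) - s j.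
    under eq_bigr do rewrite -addnS.
    by rewrite (telescope_sumr (fun k => s (j + k)))// addn0.
  apply: le_trans (ltW big); rewrite le_eqVlt; apply/orP; left; apply/eqP.
  by field; rewrite gt_eqF.
apply/negP; rewrite -ltNge.
apply: (@le_lt_trans _ _ (\sum_(0 <= k < n.-1) t k)).
  apply: (@le_trans _ _ (\sum_(0 <= k < l) t (j + k))).
    apply: ler_sum => k _; rewrite tE lerDr; exact: sqr_ge0.
  by apply: sum_nat_sub_le => //; lia.
apply: lt_le_trans small _.
have -> : l%:R * (r / (4 * l%:R)) ^+ 2 = r ^+ 2 / (16 * l%:R).
  by field; rewrite gt_eqF.
rewrite ler_pdivlMr ?mulr_gt0//.
have lm' : l%:R <= m%:R :> R by rewrite ler_nat.
have -> : m%:R * r ^+ 4 / 16 * (16 * l%:R) = (m%:R * r) * (l%:R * r) * r ^+ 2.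
  by field.
rewrite ler_piMl ?sqr_ge0//.
have : l%:R * r <= 1 by rewrite (le_trans _ mr)// ler_pM2r.
have : 0 <= l%:R * r by rewrite mulr_ge0// ltW.
have : 0 <= m%:R * r by rewrite mulr_ge0// ltW.
by move=> *; rewrite mulr_ile1.
Qed.

(* The sine of the increment varies by at most [r / 4] over [m] steps; were it
   small somewhere, [m] consecutive triples would each cost about [r ^+ 4]. *)
Lemma chain_rigid (n m : nat) : (0 < m < n)%N -> m%:R * r <= 1 ->
  (forall k, (k < n)%N -> `|d k| <= pi / 2) ->
  \sum_(0 <= k < n.-1) t k < m%:R * r ^+ 4 / 16 ->
  (forall k, (k < n)%N -> r / 2 <= s k) \/
  (forall k, (k < n)%N -> s k <= - (r / 2)).
Proof.
move=> /andP[m0 mn] mr dpi small; have rp := r0.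
have osc j k : (j <= k <= j + m)%N -> (k < n)%N -> `|s k - s j| <= r / 4.
  move=> /andP[jk kjm] kn; have [<-|jk'] := eqVneq j k.
    by rewrite subrr normr0 divr_ge0// ltW.
  rewrite -(subnKC jk); apply: (@chain_osc n m) => //; lia.
have away k : (k < n)%N -> r / 2 < `|s k|.
  move=> kn; rewrite ltNge; apply/negP => sk.
  (* Start of a window of [m] triples whose increments include [k], moved left where needed so that
     it stays inside the chain. *)
  pose b := minn k (n.-1 - m).
  have near j : (j < m.+1)%N -> s (b + j) ^+ 2 <= (3 / 4 * r) ^+ 2.
    move=> jm; have h : `|s (b + j) - s k| <= r / 4.
      have [bk|kb] := leqP (b + j) k.
        by rewrite distrC; apply: osc => //; rewrite /b in bk *; lia.
      by apply: osc; rewrite /b in kb *; lia.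
    have r34 : 0 <= 3 / 4 * r by lra.
    rewrite -real_normK ?num_real// ler_sqr ?nnegrE//.
    by have := ler_normD (s (b + j) - s k) (s k); rewrite subrK; lra.
  have : \sum_(0 <= j < m) t (b + j) <= \sum_(0 <= k < n.-1) t k.
    by apply: sum_nat_sub_le => //; rewrite /b; lia.
  apply/negP; rewrite -ltNge; apply: lt_le_trans small _.
  have -> : m%:R * r ^+ 4 / 16 = \sum_(0 <= j < m) (r ^+ 4 / 16).
    by rewrite sumr_const_nat subn0 -mulr_natl; ring.
  rewrite !big_nat; apply: ler_sum => j /andP[_ jm]; rewrite tE.
  have h1 := near _ (ltnW jm : (j < m.+1)%N).
  have h2 := near j.+1 jm; rewrite addnS in h2.
  have g1 : 1 - cos (d (b + j)) <= s (b + j) ^+ 2.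
    by apply: one_sub_cos_le; apply: dpi; rewrite /b; lia.
  have g2 : 1 - cos (d (b + j).+1) <= s (b + j).+1 ^+ 2.
    by apply: one_sub_cos_le; apply: dpi; rewrite /b; lia.
  set x := _ + _ - 2 * (1 - _); set y := _ - _.
  (* Each [1 - cos] is at most [9 / 16 * r ^ 2], which leaves at least [7 / 8 * r ^ 2] of the
     [2 * r ^ 2]. *)
  have x2 : r ^+ 2 / 4 <= x by rewrite /x; have := sqr_ge0 r; nra.
  have : 0 <= y ^+ 2 by exact: sqr_ge0.
  have : (r ^+ 2 / 4) ^+ 2 <= x ^+ 2.
    rewrite ler_sqr ?nnegrE//; first by rewrite divr_ge0// sqr_ge0.
    by rewrite (le_trans _ x2)// divr_ge0// sqr_ge0.
  have -> : (r ^+ 2 / 4) ^+ 2 = r ^+ 4 / 16 by field.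
  by move=> *; lra.
have step k : (k.+1 < n)%N -> `|s k.+1 - s k| <= r / 4.
  by move=> kn; apply: osc => //; lia.
(* The sign propagates along the chain: a step of at most [r / 4] cannot cross the gap between
   [- r / 2] and [r / 2]. *)
have [s0|s0] := leP 0 (s 0%N); [left|right]; elim=> [|k IH] kn.
- by have := away _ kn; rewrite ger0_norm// => /ltW.
- have := IH (ltnW kn); have := away _ kn; have := step _ kn.
  rewrite ler_norml => /andP[h _] aw sk.
  by move: aw; rewrite ger0_norm; lra.
- by have := away _ kn; rewrite ltr0_norm//; lra.
- have := IH (ltnW kn); have := away _ kn; have := step _ kn.
  rewrite ler_norml => /andP[_ h] aw sk.
  by move: aw; rewrite ltr0_norm; lra.
Qed.

(* A block without transition is monotone, so the chain cannot stay in the cone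
   [|f| <= 6 r i] near both ends. *)
Lemma chain_block (i m : nat) : (0 < m <= i)%N -> m%:R * r <= 1 ->
  (forall k, (k < 40 * i)%N -> `|d k| <= pi / 2) ->
  m%:R * r ^+ 4 / 16 <= \sum_(0 <= k < (40 * i).-1) t k
  \/ exists a : nat, (a + 5 * i <= 40 * i)%N /\
       forall k, (k < 5 * i)%N -> 6 * r * i%:R < `|f (a + k)|.
Proof.
move=> /andP[m0 mi] mr dpi; have rp := r0.
have [h|h] := leP (m%:R * r ^+ 4 / 16) (\sum_(0 <= k < (40 * i).-1) t k).
  by left.
right; apply: contrapT => nbad.
have good a : (a + 5 * i <= 40 * i)%N ->
    exists2 k, (k < 5 * i)%N & `|f (a + k)| <= 6 * r * i%:R.
  move=> ai; apply: contrapT => ng; apply: nbad; exists a; split=> // k ki.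
  by rewrite ltNge; apply/negP => gk; apply: ng; exists k.
(* One point of the cone among the first [5 * i] rows and one among the last [5 * i] are at least
   [30 * i] rows apart. Growth at rate [r / 2] separates their angles by [15 * r * i], whereas the
   cone allows only [12 * r * i]. *)
have [k1 k1i b1] := good 0%N ltac:(lia).
have [k2 k2i b2] := good (35 * i)%N ltac:(lia).
rewrite add0n in b1.
have k12 : (k1 <= 35 * i + k2)%N by lia.
have ik : (30 * i)%:R <= ((35 * i + k2) - k1)%:R :> R by rewrite ler_nat; lia.
have i0 : 0 < i%:R :> R by rewrite ltr0n; lia.
have sumd : \sum_(k1 <= k < 35 * i + k2) d k = f (35 * i + k2) - f k1.
  exact: telescope_sumr.
have absd k : (k < 40 * i)%N -> `|s k| <= `|d k|.
  move=> ki; have [d0|d0] := leP 0 (d k).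
    by have := sin_sub_le d0; rewrite sin0 !subr0 (ger0_norm d0).
  by have := sin_sub_le (ltW d0); rewrite sin0 !sub0r normrN (ltr0_norm d0).
have key : (30 * i)%:R * (r / 2) <= `|f (35 * i + k2) - f k1|.
  apply: (@le_trans _ _ (((35 * i + k2) - k1)%:R * (r / 2))).
    by rewrite ler_pM2r// divr_gt0.
  rewrite -sumd.
  have pos : (forall k, (k < 40 * i)%N -> r / 2 <= d k) ->
      ((35 * i + k2) - k1)%:R * (r / 2) <= \sum_(k1 <= k < 35 * i + k2) d k.
    move=> dk; rewrite mulr_natl -sumr_const_nat !big_nat.
    by apply: ler_sum => k /andP[_ ?]; apply: dk; lia.
  have neg : (forall k, (k < 40 * i)%N -> d k <= - (r / 2)) ->
      ((35 * i + k2) - k1)%:R * (r / 2) <= - \sum_(k1 <= k < 35 * i + k2) d k.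
    move=> dk; rewrite mulr_natl -sumr_const_nat -sumrN !big_nat.
    by apply: ler_sum => k /andP[_ ?]; rewrite lerNr; apply: dk; lia.
  have mn : (0 < m < 40 * i)%N by lia.
  have [sk|sk] := chain_rigid mn mr dpi h.
    apply: le_trans (ler_norm _); apply: pos => k ki.
    have := absd _ ki; have := sk _ ki; have := dpi _ ki; rewrite /s => dk sk' ds.
    have [d0|d0] := leP 0 (d k).
      by move: ds; rewrite (ger0_norm d0) ger0_norm//; lra.
    have : sin (- d k) >= 0.
      apply: sin_ge0_pi; rewrite oppr_ge0 (ltW d0)/=.
      by move: dk; rewrite ltr0_norm//; have := pi_gt0 R; lra.
    by rewrite sinN; lra.
  rewrite -normrN; apply: le_trans (ler_norm _); apply: neg => k ki.
  have := absd _ ki; have := sk _ ki; have := dpi _ ki; rewrite /s => dk sk' ds.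
  have [d0|d0] := leP 0 (d k).
    have : sin (d k) >= 0.
      apply: sin_ge0_pi; rewrite d0/=.
      by move: dk; rewrite ger0_norm//; have := pi_gt0 R; lra.
    by lra.
  by move: ds; rewrite (ltr0_norm d0) ler0_norm//; lra.
have := ler_normB (f (35 * i + k2)) (f k1).
have : 0 < r * i%:R by rewrite mulr_gt0.
by rewrite natrM in key; lra.
Qed.

End Chain.

(** * Lifting a field of small energy *)

Section Lift.
Variable R : realType.
Implicit Types (x y z : R * R) (v : nat -> nat -> R * R).

Definition dotv x y : R := x.1 * y.1 + x.2 * y.2.
Definition crossv x y : R := x.1 * y.2 - x.2 * y.1.

(** Project the residual on [y]: the two scalar products add up to at least
    [2 * (1 - 1 / 400) - 1 / 200 = 199 / 100], and neither exceeds 1. *)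
Lemma dens_dotv delta x y z : unit_vec x -> unit_vec y -> unit_vec z ->
  0 < delta <= 1 / 400 -> dens delta x y z <= (1 / 200) ^+ 2 ->
  99 / 100 <= dotv x y /\ 99 / 100 <= dotv y z.
Proof.
rewrite /unit_vec /dens /dotv; case: x y z => [x1 x2] [y1 y2] [z1 z2]/= hx hy hz.
move=> hd; set w1 := _ - _ + z1; set w2 := _ - _ + z2 => hw.
have cs : (w1 * y1 + w2 * y2) ^+ 2 <= (1 / 200) ^+ 2.
  apply: le_trans hw; rewrite -[leRHS]mulr1 -hy -subr_ge0.
  have -> : (w1 ^+ 2 + w2 ^+ 2) * (y1 ^+ 2 + y2 ^+ 2) - (w1 * y1 + w2 * y2) ^+ 2
     = (w1 * y2 - w2 * y1) ^+ 2 by ring.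
  exact: sqr_ge0.
have wy : - (1 / 200) <= w1 * y1 + w2 * y2 by nra.
have wE : w1 * y1 + w2 * y2 =
    (x1 * y1 + x2 * y2) + (y1 * z1 + y2 * z2) - 2 * (1 - delta) * (y1 ^+ 2 + y2 ^+ 2).
  by rewrite /w1 /w2; ring.
rewrite hy in wE.
have xy : x1 * y1 + x2 * y2 <= 1.
  by have := sqr_ge0 (x1 - y1); have := sqr_ge0 (x2 - y2); lra.
have yz : y1 * z1 + y2 * z2 <= 1.
  by have := sqr_ge0 (y1 - z1); have := sqr_ge0 (y2 - z2); lra.
split; lra.
Qed.

Lemma angle_between x y : unit_vec x -> unit_vec y -> 0 <= dotv x y ->
  exists q, [/\ `|q| <= pi / 2, sin q = crossv x y & cos q = dotv x y].
Proof.
rewrite /unit_vec => hx hy d0.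
have e : crossv x y ^+ 2 + dotv x y ^+ 2 = 1.
  rewrite -[RHS]mulr1 -{1}hx -hy /crossv /dotv; ring.
have c1 : -1 <= crossv x y <= 1 by apply/andP; split; nra.
exists (asin (crossv x y)); split.
- by rewrite ler_norml asin_geNpi2// asin_lepi2.
- by rewrite asinK// in_itv.
- rewrite cos_asin// (_ : 1 - _ = dotv x y ^+ 2); last by rewrite -e; ring.
  by rewrite sqrtr_sqr ger0_norm.
Qed.

Lemma angle_small q : `|q| <= pi / 2 -> 99 / 100 <= cos q -> `|q| <= 3 / 10 :> R.
Proof.
move=> qpi cq; have := abs_le_sin qpi; have := cos2Dsin2 q.
have := cos_le1 q; rewrite -[sin q ^+ 2]real_normK ?num_real//.
by have := normr_ge0 (sin q); nra.
Qed.

(** The lift sums the horizontal angles along each row, starting at the boundary column. Its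
    vertical increments are a priori known only modulo [2 * pi]; by induction on the column they are
    at most [3 / 10] by [angle_small], so in the next column at most [9 / 10], still below
    [pi / 2]. *)
Lemma lift_exists (N : nat) v : admissible v ->
  (forall i j, (i.+1 < N)%N -> (j < N)%N -> 99 / 100 <= dotv (v i j) (v i.+1 j)) ->
  (forall i j, (i < N)%N -> (j.+1 < N)%N -> 99 / 100 <= dotv (v i j) (v i j.+1)) ->
  exists phi : nat -> nat -> R,
  [/\ forall j, phi 0%N j = 0,
      forall i j, (i < N)%N -> (j < N)%N -> v i j = expi (phi i j),
      forall i j, (i.+1 < N)%N -> (j < N)%N -> `|phi i.+1 j - phi i j| <= pi / 2 &
      forall i j, (i < N)%N -> (j.+1 < N)%N -> `|phi i j.+1 - phi i j| <= pi / 2].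
Proof.
move=> [v1 v0] hor ver.
have p1 : 1 <= pi / 2 :> R by have := pi_ge2 R; lra.
have /choice[q0 qP0] (p : nat * nat) : exists q, (p.1.+1 < N)%N -> (p.2 < N)%N ->
    [/\ `|q| <= pi / 2, sin q = crossv (v p.1 p.2) (v p.1.+1 p.2)
      & cos q = dotv (v p.1 p.2) (v p.1.+1 p.2)].
  case: p => i j /=; case: (boolP ((i.+1 < N)%N && (j < N)%N)) => [/andP[iN jN]|h].
    have d0 : 0 <= dotv (v i j) (v i.+1 j) by have := hor _ _ iN jN; lra.
    by have [q qP] := angle_between (v1 i j) (v1 i.+1 j) d0; exists q.
  by exists 0 => iN jN; rewrite iN jN in h.
pose q i j := q0 (i, j).
have qP i j : (i.+1 < N)%N -> (j < N)%N -> [/\ `|q i j| <= pi / 2,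
  sin (q i j) = crossv (v i j) (v i.+1 j) & cos (q i j) = dotv (v i j) (v i.+1 j)].
  exact: (qP0 (i, j)).
pose phi i j := \sum_(0 <= k < i) q k j.
have phiS i j : phi i.+1 j = phi i j + q i j by rewrite /phi big_nat_recr.
have phi0 j : phi 0%N j = 0 by rewrite /phi big_geq.
have vE i j : (i < N)%N -> (j < N)%N -> v i j = expi (phi i j).
  elim: i => [|i IH] iN jN; first by rewrite phi0 v0 /expi cos0 sin0.
  have [_ sq cq] := qP _ _ iN jN; have e := IH (ltnW iN) jN.
  have u : (v i j).1 ^+ 2 + (v i j).2 ^+ 2 = 1 := v1 i j.
  rewrite /expi phiS cosD sinD.
  have -> : cos (phi i j) = (v i j).1 by rewrite e.
  have -> : sin (phi i j) = (v i j).2 by rewrite e.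
  rewrite sq cq /crossv /dotv [LHS]surjective_pairing; congr (_, _).
    rewrite -[LHS]mul1r -u; ring.
  rewrite -[LHS]mul1r -u; ring.
have qsmall i j : (i.+1 < N)%N -> (j < N)%N -> `|q i j| <= 3 / 10.
  move=> iN jN; have [qpi _ cq] := qP _ _ iN jN.
  by apply: angle_small => //; rewrite cq; exact: hor.
exists phi; split => // [i j iN jN|i j].
  by rewrite phiS addrAC subrr add0r; have [] := qP _ _ iN jN.
elim: i => [|i IH] iN jN; first by rewrite !phi0 subrr normr0; lra.
have p0 := IH (ltnW iN) jN.
have : `|phi i j.+1 - phi i j| <= 3 / 10.
  apply: angle_small => //; have := ver _ _ (ltnW iN) jN.
  rewrite !vE ?(ltnW iN) ?(ltnW jN)// /dotv/= cosB; lra.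
have := qsmall _ _ iN jN; have := qsmall _ _ iN (ltnW jN).
rewrite !phiS !ler_norml => /andP[? ?] /andP[? ?] /andP[? ?].
by apply/andP; split; lra.
Qed.

Lemma grid_energy_ge_hor N delta v i j : (i.+2 < N)%N -> (j < N)%N ->
  dens delta (v i j) (v i.+1 j) (v i.+2 j) <= grid_energy N delta v.
Proof.
move=> iN jN; rewrite /grid_energy.
have i2 : (i < N.-2)%N by lia.
rewrite (bigD1_seq j) ?mem_index_iota ?iota_uniq//=.
rewrite (bigD1_seq i) ?mem_index_iota ?iota_uniq//=.
do 3?apply: ler_wpDr => //; do 2?(apply: sumr_ge0 => ? _); exact: dens_ge0.
Qed.

Lemma grid_energy_ge_ver N delta v i j : (i < N)%N -> (j.+2 < N)%N ->
  dens delta (v i j) (v i j.+1) (v i j.+2) <= grid_energy N delta v.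
Proof.
move=> iN jN; rewrite /grid_energy.
have j2 : (j < N.-2)%N by lia.
rewrite addrC (bigD1_seq i) ?mem_index_iota ?iota_uniq//=.
rewrite (bigD1_seq j) ?mem_index_iota ?iota_uniq//=.
do 3?apply: ler_wpDr => //; do 2?(apply: sumr_ge0 => ? _); exact: dens_ge0.
Qed.

Lemma lift_of_small_energy N delta v : admissible v -> (2 < N)%N ->
  0 < delta <= 1 / 400 -> grid_energy N delta v <= (1 / 200) ^+ 2 ->
  exists phi : nat -> nat -> R,
  [/\ forall j, phi 0%N j = 0,
      grid_energy N delta v = grid_energy N delta (fun i j => expi (phi i j)),
      forall i j, (i.+1 < N)%N -> (j < N)%N -> `|phi i.+1 j - phi i j| <= pi / 2 &
      forall i j, (i < N)%N -> (j.+1 < N)%N -> `|phi i j.+1 - phi i j| <= pi / 2].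
Proof.
move=> va N2 hd small; have [v1 _] := va.
have hor i j : (i.+1 < N)%N -> (j < N)%N -> 99 / 100 <= dotv (v i j) (v i.+1 j).
  move=> iN jN; have [i2|i2] := ltnP i.+2 N.
    have h := le_trans (grid_energy_ge_hor delta v i2 jN) small.
    by have [] := dens_dotv (v1 _ _) (v1 _ _) (v1 _ _) hd h.
  (* No triple starts at the last edge of a row; that edge is the second one of the preceding
     triple. *)
  case: i iN i2 => [|i] iN i2; first by lia.
  have h := le_trans (grid_energy_ge_hor delta v iN jN) small.
  by have [] := dens_dotv (v1 _ _) (v1 _ _) (v1 _ _) hd h.
have ver i j : (i < N)%N -> (j.+1 < N)%N -> 99 / 100 <= dotv (v i j) (v i j.+1).
  move=> iN jN; have [j2|j2] := ltnP j.+2 N.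
    have h := le_trans (grid_energy_ge_ver delta v iN j2) small.
    by have [] := dens_dotv (v1 _ _) (v1 _ _) (v1 _ _) hd h.
  case: j jN j2 => [|j] jN j2; first by lia.
  have h := le_trans (grid_energy_ge_ver delta v iN jN) small.
  by have [] := dens_dotv (v1 _ _) (v1 _ _) (v1 _ _) hd h.
have [phi [phi0 vE ph pv]] := lift_exists va hor ver.
exists phi; split => //; rewrite /grid_energy; congr (_ + _).
  apply: eq_big_nat => j /andP[_ jN]; apply: eq_big_nat => i /andP[_ iN].
  by rewrite !vE//; lia.
apply: eq_big_nat => i /andP[_ iN]; apply: eq_big_nat => j /andP[_ jN].
by rewrite !vE//; lia.
Qed.

(** The field is constant on the boundary column, so each vertical triple there costs
    [(2 * delta) ^ 2]. *)
Lemma grid_energy_col0 N delta v : admissible v -> (2 < N)%N ->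
  4 * delta ^+ 2 * (N.-2)%:R <= grid_energy N delta v.
Proof.
move=> [_ v0] N2; rewrite /grid_energy [leRHS]addrC.
rewrite (bigD1_seq 0%N) ?mem_index_iota ?iota_uniq//=; last by lia.
have -> : \sum_(0 <= j < N.-2) dens delta (v 0%N j) (v 0%N j.+1) (v 0%N j.+2)
    = 4 * delta ^+ 2 * (N.-2)%:R.
  under eq_bigr do rewrite !v0 /dens/=.
  by rewrite sumr_const_nat subn0 -mulr_natl; ring.
do 2?apply: ler_wpDr => //; do 2?(apply: sumr_ge0 => ? _); exact: dens_ge0.
Qed.

End Lift.

(** * Energy of a column *)

Section Lower.
Variable R : realType.

Lemma sum_blocks_le (F : nat -> R) (B n M : nat) : (forall k, 0 <= F k) ->
  (B * n <= M)%N ->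
  \sum_(0 <= b < B) \sum_(0 <= k < n) F (b * n + k)%N <= \sum_(0 <= k < M) F k.
Proof.
move=> F0 BM; apply: (@le_trans _ _ (\sum_(0 <= k < B * n) F k)).
  rewrite big_nat_mul; apply: ler_sum => b _.
  rewrite -[X in _ <= \sum_(X <= _ < _) _]add0n big_addn mulSn addnK.
  by under [leRHS]eq_bigr do rewrite addnC.
by have := @sum_nat_sub_le _ F 0 (B * n) M F0 BM.
Qed.

Variables (N : nat) (r : R) (phi : nat -> nat -> R).
Hypothesis r0 : 0 < r.
Hypothesis phi0 : forall j, phi 0%N j = 0.
Hypothesis phi_hor : forall i j, (i.+1 < N)%N -> (j < N)%N ->
  `|phi i.+1 j - phi i j| <= pi / 2.
Hypothesis phi_ver : forall i j, (i < N)%N -> (j.+1 < N)%N ->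
  `|phi i j.+1 - phi i j| <= pi / 2.

Let w i j := expi (phi i j).
Let row j : R :=
  \sum_(0 <= i < N.-2) dens (r ^+ 2) (w i j) (w i.+1 j) (w i.+2 j).
Let col i : R :=
  \sum_(0 <= j < N.-2) dens (r ^+ 2) (w i j) (w i j.+1) (w i j.+2).
Let H : R := \sum_(0 <= j < N) row j.

(** Column [i] is cut into [B] blocks, to which [chain_block] applies. Its alternatives are made
    comparable by counting each expensive row with weight [m * r ^ 4 / (80 * i)], so that [5 * i] of
    them are worth one transition. By [chain_drift] an expensive row carries energy [4 * r ^ 4 * i],
    so their number is controlled by [H]. *)
Lemma column_energy (i m : nat) : (0 < m <= i)%N -> m%:R * r <= 1 ->
  (40 * i + 2 <= N)%N ->
  N%:R * m%:R * r ^+ 4 / (100 * i%:R)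
    <= 16 * col i + m%:R / (20 * i%:R ^+ 2) * H.
Proof.
move=> /andP[m0 mi] mr iN; have i0 : (0 < i)%N by lia.
have i0' : 0 < i%:R :> R by rewrite ltr0n.
have m0' : 0 < m%:R :> R by rewrite ltr0n.
have r4 : 0 < r ^+ 4 by rewrite exprn_gt0.
set n := (40 * i)%N; pose B := (N.-2 %/ n)%N.
have B0 : (0 < B)%N by rewrite divn_gt0 /n; lia.
have Bn : (B * n <= N.-2)%N := leq_trunc_div _ _.
(* As [B] is positive, [(B + 1) * 40 <= 80 * B]; the rest of the factor 100 absorbs the two rows
   lost in [N.-2]. *)
have NB : (N <= 100 * i * B)%N.
  have : (N.-2 < B.+1 * n)%N by apply: ltn_ceil; rewrite /n; lia.
  by rewrite /n; nia.
pose t k := dens (r ^+ 2) (w i k) (w i k.+1) (w i k.+2).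
(* Indicator of the expensive rows. *)
pose chi j : R := if 6 * r * i%:R < `|phi i j| then 1 else 0.
have chi0 j : 0 <= chi j by rewrite /chi; case: ifP.
have t0 k : 0 <= t k by exact: dens_ge0.
have row0 j : 0 <= row j by apply: sumr_ge0 => ? _; exact: dens_ge0.
have chi_row j : (j < N)%N -> 4 * r ^+ 4 * i%:R * chi j <= row j.
  move=> jN; rewrite /chi; case: ifP => [big|_]; last by rewrite mulr0.
  rewrite mulr1; apply: le_trans (@sum_nat_sub_le _ _ 0 i N.-2 _ _); last 2 first.
  - by move=> k; exact: dens_ge0.
  - by lia.
  apply: (@chain_drift _ r (phi^~ j)) => // k ki; apply: phi_hor => //; lia.
have block b : (b < B)%N -> m%:R * r ^+ 4 / 16
    <= \sum_(0 <= k < n) t (b * n + k)%N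
       + m%:R * r ^+ 4 / (80 * i%:R) * \sum_(0 <= k < n) chi (b * n + k)%N.
  move=> bB; have bn : (b * n + n <= N.-2)%N.
    by apply: leq_trans Bn; rewrite -mulSnr leq_mul2r bB orbT.
  have dpi k : (k < n)%N ->
      `|phi i (b * n + k.+1)%N - phi i (b * n + k)%N| <= pi / 2.
    by move=> kn; rewrite addnS; apply: phi_ver; lia.
  have S0 : 0 <= \sum_(0 <= k < n) chi (b * n + k)%N.
    by apply: sumr_ge0 => ? _.
  have c0 : 0 <= m%:R * r ^+ 4 / (80 * i%:R).
    by rewrite divr_ge0 ?mulr_ge0 ?ltW.
  have mi' : (0 < m <= i)%N by rewrite m0.
  have [h|[a [ai bad]]] := @chain_block _ r (fun k => phi i (b * n + k)%N) r0 i m mi' mr dpi.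
    apply: ler_wpDr; first by rewrite mulr_ge0.
    apply: (le_trans h); rewrite /t.
    under eq_bigr do rewrite !addnS.
    by apply: (@sum_nat_sub_le _ (fun k => t (b * n + k)%N) 0) => //; exact: leq_pred.
  apply: ler_wpDl; first by apply: sumr_ge0 => ? _.
  have -> : m%:R * r ^+ 4 / 16 = m%:R * r ^+ 4 / (80 * i%:R) * (5 * i)%:R.
    by rewrite natrM; field; rewrite gt_eqF.
  rewrite ler_wpM2l//.
  apply: (@le_trans _ _ (\sum_(0 <= k < 5 * i) chi (b * n + (a + k))%N)).
    have -> : (5 * i)%:R = \sum_(0 <= k < 5 * i) 1 :> R.
      by rewrite sumr_const_nat subn0.
    rewrite !big_nat; apply: ler_sum => k /andP[_ ki].
    by rewrite /chi bad.
  exact: (@sum_nat_sub_le _ (fun k => chi (b * n + k)%N)).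
have sumb : B%:R * (m%:R * r ^+ 4 / 16)
    <= col i + m%:R / (320 * i%:R ^+ 2) * H.
  have -> : B%:R * (m%:R * r ^+ 4 / 16) = \sum_(0 <= b < B) (m%:R * r ^+ 4 / 16).
    by rewrite sumr_const_nat subn0 mulr_natl.
  apply: (@le_trans _ _ (\sum_(0 <= b < B) (\sum_(0 <= k < n) t (b * n + k)%N
       + m%:R * r ^+ 4 / (80 * i%:R) * \sum_(0 <= k < n) chi (b * n + k)%N))).
    by rewrite !big_nat; apply: ler_sum => b /andP[_ bB]; exact: block.
  rewrite big_split/= lerD//; first exact: (sum_blocks_le t0 Bn).
  rewrite -mulr_sumr.
  have -> : m%:R / (320 * i%:R ^+ 2) * H =
      m%:R * r ^+ 4 / (80 * i%:R) * (H / (4 * r ^+ 4 * i%:R)).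
    by field; rewrite !gt_eqF.
  rewrite ler_wpM2l//; first by rewrite divr_ge0 ?mulr_ge0 ?ltW.
  rewrite ler_pdivlMr ?mulr_gt0//.
  apply: (@le_trans _ _ (\sum_(0 <= j < N) (4 * r ^+ 4 * i%:R * chi j))).
    have c0 : 0 <= 4 * r ^+ 4 * i%:R by rewrite !mulr_ge0// ltW.
    rewrite -mulr_sumr mulrC ler_wpM2l//.
    by apply: (sum_blocks_le chi0); lia.
  by rewrite /H !big_nat; apply: ler_sum => j /andP[_ jN]; exact: chi_row.
have NB' : N%:R <= 100 * i%:R * B%:R :> R by rewrite -!natrM ler_nat.
rewrite ler_pdivrMr ?mulr_gt0//.
have e : (16 * col i + m%:R / (20 * i%:R ^+ 2) * H) * (100 * i%:R) =
  16 * (100 * i%:R) * (col i + m%:R / (320 * i%:R ^+ 2) * H).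
  by field; rewrite gt_eqF.
rewrite e; apply: (@le_trans _ _ (16 * (100 * i%:R) * (B%:R * (m%:R * r ^+ 4 / 16)))).
  have -> : 16 * (100 * i%:R) * (B%:R * (m%:R * r ^+ 4 / 16)) =
    (100 * i%:R * B%:R) * (m%:R * r ^+ 4) by field.
  by rewrite -mulrA ler_wpM2r// mulr_ge0// ltW.
by rewrite ler_wpM2l// !mulr_ge0// ltW.
Qed.

(** Each term is at most [2 / i - 2 / (i + 1)], and these differences telescope. *)
Lemma sum_inv_sqr_le (m K : nat) : (0 < m)%N ->
  \sum_(m <= i < K) (i%:R ^+ 2)^-1 <= 2 / m%:R :> R.
Proof.
move=> m0; have [Km|mK] := leqP K m.
  by rewrite big_geq// divr_ge0.
apply: (@le_trans _ _ (\sum_(m <= i < K) ((- (2 / i.+1%:R)) - (- (2 / i%:R))))).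
  rewrite !big_nat; apply: ler_sum => i /andP[mi _].
  have i0 : 1 <= i%:R :> R by rewrite ler1n (leq_trans m0).
  rewrite -[i.+1%:R]natr1 -subr_ge0.
  have -> : - (2 / (i%:R + 1)) - - (2 / i%:R) - (i%:R ^+ 2)^-1 =
      (i%:R - 1) / (i%:R ^+ 2 * (i%:R + 1)) :> R.
    by field; apply/andP; split; rewrite gt_eqF//; lra.
  by rewrite divr_ge0 ?mulr_ge0 ?sqr_ge0//; lra.
rewrite (telescope_sumr (fun i => - (2 / i%:R)) (ltnW mK)) opprK addrC.
by rewrite lerBlDr lerDl divr_ge0.
Qed.

(* The contribution of the expensive rows is absorbed in the left-hand side since
   [\sum_(i >= m) i ^- 2 <= 2 / m]. *)
Lemma scales_energy (m K : nat) : (0 < m <= K)%N -> m%:R * r <= 1 ->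
  (40 * K.-1 + 2 <= N)%N ->
  N%:R * m%:R * r ^+ 4 / 1600 * \sum_(m <= i < K) (i%:R)^-1
    <= grid_energy N (r ^+ 2) w.
Proof.
move=> /andP[m0 mK] mr KN.
have m0' : 0 < m%:R :> R by rewrite ltr0n.
have H0 : 0 <= H.
  by apply: sumr_ge0 => ? _; apply: sumr_ge0 => ? _; exact: dens_ge0.
have col0 i : 0 <= col i by apply: sumr_ge0 => ? _; exact: dens_ge0.
have -> : grid_energy N (r ^+ 2) w = H + \sum_(0 <= i < N) col i by [].
have colN : \sum_(m <= i < K) col i <= \sum_(0 <= i < N) col i.
  rewrite -[X in \sum_(X <= _ < _) _]add0n big_addn.
  under eq_bigr do rewrite addnC.
  by apply: sum_nat_sub_le => //; lia.
have : \sum_(m <= i < K) (N%:R * m%:R * r ^+ 4 / (100 * i%:R))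
    <= \sum_(m <= i < K) (16 * col i + m%:R / (20 * i%:R ^+ 2) * H).
  rewrite !big_nat; apply: ler_sum => i /andP[mi iK].
  by apply: column_energy => //; [rewrite m0|lia].
have -> : \sum_(m <= i < K) (N%:R * m%:R * r ^+ 4 / (100 * i%:R)) =
   N%:R * m%:R * r ^+ 4 / 100 * \sum_(m <= i < K) (i%:R)^-1.
  by rewrite mulr_sumr; apply: eq_bigr => i _; rewrite invfM mulrA.
have -> : \sum_(m <= i < K) (16 * col i + m%:R / (20 * i%:R ^+ 2) * H) =
   16 * \sum_(m <= i < K) col i
   + m%:R / 20 * (\sum_(m <= i < K) (i%:R ^+ 2)^-1) * H.
  rewrite big_split/=; congr (_ + _); first by rewrite mulr_sumr.
  rewrite -mulr_suml; congr (_ * _); rewrite mulr_sumr.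
  by apply: eq_bigr => i _; rewrite invfM !mulrA.
have : m%:R / 20 * (\sum_(m <= i < K) (i%:R ^+ 2)^-1) * H <= 1 / 10 * H.
  rewrite ler_wpM2r// (_ : 1 / 10 = m%:R / 20 * (2 / m%:R)); last first.
    by field; rewrite gt_eqF.
  by rewrite ler_wpM2l ?sum_inv_sqr_le// divr_ge0// ltW.
lra.
Qed.

End Lower.

(** * Lower bound *)

Section LowerBound.
Variable R : realType.

Lemma ln_le_harmonic (m K : nat) : (0 < m <= K)%N ->
  ln (K%:R / m%:R) <= \sum_(m <= i < K) (i%:R)^-1 :> R.
Proof.
move=> /andP[m0 mK].
have m0' : 0 < m%:R :> R by rewrite ltr0n.
have K0' : 0 < K%:R :> R by rewrite ltr0n (leq_trans m0).
rewrite ln_div ?posrE// -(@telescope_sumr _ m K (fun i => ln i%:R) mK).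
rewrite !big_nat; apply: ler_sum => i /andP[mi _].
have i0 : 0 < i%:R :> R by rewrite ltr0n (leq_trans m0).
suff : ln (i%:R + 1) - ln i%:R <= i%:R^-1 :> R by rewrite natr1.
rewrite -ln_div ?posrE ?ltr_wpDr// mulrDl divff ?gt_eqF// mul1r.
by apply: le_ln1Dx; rewrite (lt_trans (ltrN10 R))// invr_gt0.
Qed.

Lemma half_le_ln2 : 1 / 2 <= ln (2 : R).
Proof.
have : ln (1 + (- (1 / 2))) <= - (1 / 2) :> R by apply: le_ln1Dx; lra.
have -> : 1 + (- (1 / 2)) = 2^-1 :> R by field.
by rewrite lnV ?posrE//; lra.
Qed.

(** Below [K] lie the columns whose blocks of [40 * i] rows fit into the grid; [i2], about half of
    [K], serves as the only scale when [1 / r] is too large. *)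
Lemma scale_bounds (N : nat) : (400 <= N)%N -> exists K i2 : nat,
  [/\ (40 * K.-1 + 2 <= N <= 80 * K)%N, (2 * i2 < K)%N, (0 < i2)%N,
      (N <= 160 * i2)%N & (K <= N)%N].
Proof.
move=> N400; exists (N.-2 %/ 40).+1, (N.-2 %/ 40 %/ 2)%N => /=.
have := leq_trunc_div N.-2 40; have := @ltn_ceil N.-2 40 isT.
set k := (N.-2 %/ 40)%N.
have := leq_trunc_div k 2; have := @ltn_ceil k 2 isT.
set i := (k %/ 2)%N; clearbody k; clearbody i => h1 h2 h3 h4.
by split; lia.
Qed.

(** The three alternatives are a misaligned triple, a grid too small for scales beyond [1 / r], and
    a grid with room for them, where the harmonic sum yields the logarithm. *)
Lemma grid_energy_lower (N : nat) (r c : R) (v : nat -> nat -> R * R) :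
  0 < c -> c * 1000 <= 1 / 1000 -> admissible v -> (2 < N)%N -> 0 < r <= 1 / 20 ->
  [\/ (1 / 200) ^+ 2 <= grid_energy N (r ^+ 2) v,
      c * (N%:R ^+ 2 * r ^+ 4) <= grid_energy N (r ^+ 2) v |
      1 <= N%:R * r /\
      c * (N%:R * r ^+ 3) * (ln (N%:R * r) + 1) <= grid_energy N (r ^+ 2) v].
Proof.
move=> c0 c1 va N2 /andP[r0 r20].
have [big|small] := leP ((1 / 200) ^+ 2) (grid_energy N (r ^+ 2) v).
  by constructor 1.
have N0 : 0 < N%:R :> R by rewrite ltr0n (ltn_trans _ N2).
have r4 : 0 < r ^+ 4 by rewrite exprn_gt0.
have [N400|N400] := ltnP N 400.
  constructor 2; apply: le_trans (grid_energy_col0 (r ^+ 2) va N2).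
  have -> : 4 * (r ^+ 2) ^+ 2 * N.-2%:R = r ^+ 4 * (4 * N.-2%:R) by ring.
  rewrite mulrA [leLHS]mulrC ler_pM2l//.
  have : 1 <= N.-2%:R :> R by rewrite ler1n -subn2 subn_gt0.
  have : N%:R <= 400 :> R by rewrite ler_nat ltnW.
  clear - c0 c1 N0 => N4 N2.
  have cN : c * N%:R <= 1 / 1000 by nra.
  nra.
have hd : 0 < r ^+ 2 <= 1 / 400 by rewrite exprn_gt0//=; nra.
have [phi [phi0 -> ph pv]] := lift_of_small_energy va N2 hd (ltW small).
have scales := scales_energy r0 phi0 ph pv.
set S := grid_energy _ _ _ in scales *.
have [K [i2 [/andP[KN N80] i2K i20' i2N KleN]]] := scale_bounds N400.
(* The largest [m] with [m * r <= 1], the length of a transition. *)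
pose T := Num.truncn r^-1.
have /andP[Tr rT] : T%:R <= r^-1 < T.+1%:R.
  by apply: truncn_itv; rewrite invr_ge0 ltW.
have Tr1 : T%:R * r <= 1 by rewrite -ler_pdivlMr// div1r.
have T20 : (20 <= T)%N.
  rewrite /T truncn_ge_nat; last by rewrite invr_ge0 ltW.
  by rewrite -[r^-1]div1r ler_pdivlMr//; lra.
have [Ti|iT] := leqP T i2.
- constructor 3.
  have T0' : (0 < T)%N := leq_trans (isT : (0 < 20)%N) T20.
  have T0 : 0 < T%:R :> R by rewrite ltr0n.
  have TK2 : (2 * T <= K)%N by rewrite (leq_trans _ (ltnW i2K))// leq_mul2l.
  have TK : (0 < T <= K)%N by rewrite T0' (leq_trans _ TK2)// leq_pmull.
  have K0 : 0 < K%:R :> R by rewrite ltr0n; case/andP: TK; exact: leq_trans.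
  have rT2 : 1 <= 2 * T%:R * r.
    rewrite -ler_pdivrMr// div1r (le_trans (ltW rT))// -[T.+1%:R]natr1.
    have : 20 <= T%:R :> R by rewrite ler_nat.
    lra.
  have KN' : N%:R <= 80 * K%:R :> R by rewrite -natrM ler_nat.
  set y := K%:R / T%:R : R.
  have y2 : 2 <= y by rewrite /y ler_pdivlMr// -natrM ler_nat.
  have y0 : 0 < y by lra.
  have Ky : K%:R * r <= y by rewrite /y ler_pdivlMr//; nra.
  have Nr1 : 1 <= N%:R * r.
    have : 2 * T%:R <= N%:R :> R by rewrite -natrM ler_nat (leq_trans TK2).
    nra.
  split => //.
  have lny : 1 / 2 <= ln y.
    by apply: le_trans half_le_ln2 _; rewrite ler_ln ?posrE.
  have Nry : N%:R * r <= y ^+ 8.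
    have y7 : 128 <= y ^+ 7.
      have -> : 128 = 2 ^+ 7 :> R by ring.
      by rewrite lerXn2r ?nnegrE ?(ltW y0).
    rewrite exprS; nra.
  have lnN : ln (N%:R * r) <= 8 * ln y.
    have -> : 8 * ln y = ln (y ^+ 8) by rewrite lnXn// mulr_natl.
    by rewrite ler_ln// posrE; [exact: mulr_gt0|exact: exprn_gt0].
  apply: le_trans (scales T K TK Tr1 KN).
  have h := ln_le_harmonic TK; rewrite -/y in h.
  set hs := \sum_(_ <= _ < _) _ in h *.
  have Nr0 : 0 < N%:R * r ^+ 3 by rewrite mulr_gt0// exprn_gt0.
  have -> : N%:R * T%:R * r ^+ 4 / 1600 * hs =
     (N%:R * r ^+ 3) * (hs * (T%:R * r) / 1600) by field.
  rewrite [leLHS]mulrAC mulrC ler_pM2l//.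
  have hs0 : 0 < hs by clear - h lny; lra.
  apply: (@le_trans _ _ (c * (10 * hs))).
    by rewrite ler_pM2l//; clear - h lny lnN; lra.
  clear - c0 c1 rT2 hs0; nra.
(* Now [N] is at most a multiple of [1 / r]. The scales from [i2] to [K] with [m = i2] have harmonic
   sum at least [1 / 2], and [i2] is comparable with [N]. *)
- constructor 2.
  have i20 : 0 < i2%:R :> R by rewrite ltr0n.
  have ir : i2%:R * r <= 1.
    by apply: le_trans Tr1; rewrite ler_pM2r// ler_nat ltnW.
  have iK : (0 < i2 <= K)%N by rewrite i20' (leq_trans _ (ltnW i2K))// leq_pmull.
  apply: le_trans (scales i2 K iK ir KN).
  have h : 1 / 2 <= \sum_(i2 <= i < K) (i%:R)^-1 :> R.
    apply: le_trans (ln_le_harmonic iK); apply: le_trans half_le_ln2 _.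
    have K0 : 0 < K%:R :> R by rewrite ltr0n; case/andP: iK; exact: leq_trans.
    by rewrite ler_ln ?posrE ?divr_gt0// ler_pdivlMr// -natrM ler_nat ltnW.
  have Ni : N%:R <= 160 * i2%:R :> R by rewrite -natrM ler_nat.
  set hs := \sum_(_ <= _ < _) _ in h *.
  have Nr0 : 0 < N%:R * r ^+ 4 by rewrite mulr_gt0.
  have -> : N%:R * i2%:R * r ^+ 4 / 1600 * hs =
      (N%:R * r ^+ 4) * (i2%:R * hs / 1600) by field.
  have -> : c * (N%:R ^+ 2 * r ^+ 4) = (N%:R * r ^+ 4) * (c * N%:R) by ring.
  rewrite ler_pM2l//; clear - c0 c1 Ni h i20; nra.
Qed.

Lemma powR_sqr_half (r : R) (n : nat) : 0 < r ->
  (r ^+ 2) `^ (n%:R / 2) = r ^+ n.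
Proof.
move=> r0; have rr : 0 <= r := ltW r0.
rewrite -[r ^+ 2](powR_mulrn 2 rr) -powRrM mulrC divfK ?pnatr_eq0//.
exact: powR_mulrn.
Qed.

Lemma log_scalingE (eps r : R) : 0 < r ->
  log_scaling eps (r ^+ 2) = eps * r ^+ 3 * (`|ln (eps / r)| + 1).
Proof.
move=> r0; rewrite /log_scaling (powR_sqr_half 3 r0).
by rewrite (powR_sqr_half 1 r0).
Qed.

Lemma sqrt_exists (delta : R) : 0 < delta -> exists2 r : R, 0 < r & delta = r ^+ 2.
Proof.
by move=> d0; exists (Num.sqrt delta); rewrite ?sqrtr_gt0// sqr_sqrtr// ltW.
Qed.

Lemma min_energy_lower_large (c eps delta : R) :
  0 < c -> c * 1000 <= 1 / 1000 -> 0 < eps < 1 / 2 ->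
  1 / 400 <= delta < 1 -> exists m : R, is_min_energy eps delta m /\
    c * (eps * delta `^ (1 / 2)) <= m.
Proof.
move=> c0 c1 he /andP[d4 d1]; have /andP[e0 e2] := he.
have [N [NP N2 Ne1 Ne2]] := grid_size he.
have [v va [vm _]] := min_energy_grid delta e0 N2 NP.
exists (eps ^+ 2 / 2 * grid_energy N delta v); split => //.
have e20 : 0 <= eps ^+ 2 / 2 by rewrite divr_ge0// sqr_ge0.
apply: le_trans (ler_wpM2l e20 (grid_energy_col0 delta va N2)).
have d0 : 0 < delta by lra.
have [r r0 dr] := sqrt_exists d0; rewrite dr (powR_sqr_half 1 r0) expr1.
have r1 : r <= 1.
  by rewrite -(@ler_pXn2r _ 2)// ?nnegrE ?(ltW r0)// expr1n -dr ltW.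
have N3 : N%:R <= 3 * N.-2%:R :> R.
  by rewrite -natrM ler_nat; clear -N2; lia.
have dd : 1 / 400 * (1 / 400) <= (r ^+ 2) ^+ 2 by rewrite -dr; clear - d4; nra.
have en : 1 <= 3 * (N.-2%:R * eps) by nra.
apply: (@le_trans _ _ (c * eps)); first by rewrite ler_pM2l// ler_piMr// ltW.
have -> : eps ^+ 2 / 2 * (4 * (r ^+ 2) ^+ 2 * N.-2%:R) =
   2 * (r ^+ 2) ^+ 2 * (N.-2%:R * eps) * eps by field.
rewrite ler_pM2r//; clear - c0 c1 dd en; nra.
Qed.

Lemma min_energy_lower_small (c eps delta : R) :
  0 < c -> c * 1000 <= 1 / 1000 -> 0 < delta < 1 / 400 ->
  delta <= eps < 1 / 2 -> exists m : R, is_min_energy eps delta m /\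
    c / 4 * Num.min (delta ^+ 2) (log_scaling eps delta) <= m.
Proof.
move=> c0 c1 /andP[d0 d4] /andP[de e2]; have e0 : 0 < eps by lra.
have he : 0 < eps < 1 / 2 by rewrite e0.
have [N [NP N2 Ne1 Ne2]] := grid_size he.
have [v va [vm _]] := min_energy_grid delta e0 N2 NP.
exists (eps ^+ 2 / 2 * grid_energy N delta v); split => //.
have [r r0 dr] := sqrt_exists d0.
have r20 : r <= 1 / 20.
  by rewrite leNgt; apply/negP => big; clear - d4 dr r0 big; nra.
have hr : 0 < r <= 1 / 20 by rewrite r0.
have e2p : 0 < eps ^+ 2 / 2 by rewrite divr_gt0// exprn_gt0.
have [] := grid_energy_lower c0 c1 va N2 hr; rewrite -dr => h.
- apply: (@le_trans _ _ (c / 4 * delta ^+ 2)).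
    by rewrite ler_pM2l ?divr_gt0// ge_min lexx.
  apply: le_trans (ler_wpM2l (ltW e2p) h).
  (* This is where [delta <= eps] enters: a single misaligned triple already pays for
     [delta ^ 2]. *)
  have : delta ^+ 2 <= eps ^+ 2 by rewrite ler_sqr ?nnegrE ?(ltW d0) ?(ltW e0).
  have : 0 < delta ^+ 2 by rewrite exprn_gt0.
  clear - c0 c1; nra.
- apply: (@le_trans _ _ (c / 4 * delta ^+ 2)).
    by rewrite ler_pM2l ?divr_gt0// ge_min lexx.
  apply: le_trans (ler_wpM2l (ltW e2p) h).
  have -> : eps ^+ 2 / 2 * (c * (N%:R ^+ 2 * r ^+ 4)) =
    c / 2 * (N%:R * eps) ^+ 2 * delta ^+ 2 by rewrite dr; field.
  rewrite ler_wpM2r ?sqr_ge0//; clear - c0 Ne1.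
  have : 1 <= (N%:R * eps) ^+ 2 by rewrite exprn_ege1.
  nra.
- have [Nr1 {}h] := h.
  apply: (@le_trans _ _ (c / 4 * log_scaling eps delta)).
    by rewrite ler_pM2l ?divr_gt0// ge_min lexx orbT.
  apply: le_trans (ler_wpM2l (ltW e2p) h).
  rewrite dr log_scalingE//.
  have lnr0 : 0 <= ln (N%:R * r) by rewrite ln_ge0.
  (* If [eps <= r], then [r / eps <= N * r] because [1 <= N * eps]. Otherwise [N * eps <= 3 / 2] and
     [1 <= N * r] give [eps / r <= 3 / 2]. *)
  have lner : `|ln (eps / r)| <= ln (N%:R * r) + 1 / 2.
    have er0 : 0 < eps / r by rewrite divr_gt0.
    have N0 : 0 < N%:R :> R by rewrite ltr0n (ltn_trans _ N2).
    have [le1|gt1] := leP (eps / r) 1.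
      rewrite ler0_norm; last by rewrite ln_le0.
      rewrite -lnV ?posrE// invf_div.
      suff : ln (r / eps) <= ln (N%:R * r) by lra.
      rewrite ler_ln ?posrE ?divr_gt0 ?mulr_gt0// ler_pdivrMr//.
      by rewrite mulrAC ler_peMl// ltW.
    rewrite ger0_norm; last by rewrite ln_ge0// ltW.
    have : ln (eps / r) <= ln (1 + 1 / 2).
      have p0 : 0 < 1 + 1 / 2 :> R by lra.
      rewrite ler_ln ?posrE//.
      rewrite ler_pdivrMr// -(ler_pM2r N0); clear - Ne2 Nr1; lra.
    have : ln (1 + 1 / 2) <= 1 / 2 :> R by apply: le_ln1Dx; lra.
    lra.
  have er3 : 0 < eps * r ^+ 3 by rewrite mulr_gt0// exprn_gt0.
  have -> : eps ^+ 2 / 2 * (c * (N%:R * r ^+ 3) * (ln (N%:R * r) + 1)) =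
    eps * r ^+ 3 * (c / 2 * ((N%:R * eps) * (ln (N%:R * r) + 1))) by field.
  have : ln (N%:R * r) + 1 <= N%:R * eps * (ln (N%:R * r) + 1).
    by rewrite ler_peMl// addr_ge0.
  move=> lnN; rewrite [leLHS]mulrCA ler_pM2l//; clear - c0 lner lnr0 lnN; nra.
Qed.

End LowerBound.

(** * Branching profile *)

Section Zigzag.
Local Open Scope nat_scope.

Lemma modn_addr (m j t : nat) : 0 < m -> t <= m ->
  (j + t) %% m = if j %% m + t < m then j %% m + t else j %% m + t - m.
Proof.
move=> m0 tm; have jm := ltn_pmod j m0; rewrite -modnDml.
case: ltnP => h; first by rewrite modn_small.
by rewrite -{1}(subnK h) modnDr modn_small//; lia.
Qed.

(* The distance from [j] to the multiples of [2 * h]. *)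
Definition zig (h j : nat) := minn (j %% (2 * h)) (2 * h - j %% (2 * h)).

Lemma zig_le h j : zig h j <= h.
Proof. by rewrite /zig; move: (j %% (2 * h)) => s; lia. Qed.

(** The folding step: reflecting the coarser zigzag at height [h] halves its period. *)
Lemma zig_halve h j : 0 < h ->
  zig h j = minn (zig (2 * h) j) (2 * h - zig (2 * h) j).
Proof.
move=> h0; rewrite /zig.
have -> : j %% (2 * h) = (j %% (2 * (2 * h))) %% (2 * h).
  by rewrite modn_dvdm// dvdn_mull.
have : j %% (2 * (2 * h)) < 2 * (2 * h) by rewrite ltn_pmod; lia.
move: (j %% (2 * (2 * h))) => s sh.
have [sl|sg] := ltnP s (2 * h); first by rewrite modn_small//; lia.
by rewrite -{1 2}(subnK sg) modnDr modn_small; lia.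
Qed.

Lemma zig_lip h j : 0 < h -> zig h j.+1 <= (zig h j).+1 /\ zig h j <= (zig h j.+1).+1.
Proof.
move=> h0; rewrite /zig -addn1 modn_addr; [|lia|lia].
have : j %% (2 * h) < 2 * h by rewrite ltn_pmod; lia.
by move: (j %% (2 * h)) => s sh; case: ltnP; lia.
Qed.

(** The kinks of the zigzag are the multiples of [h]; the window lies between two consecutive ones,
    on a rising or on a falling piece. *)
Lemma zig_affine h j l : 0 < h -> j %% h + l <= h ->
  (forall t, t <= l -> zig h (j + t) = zig h j + t) \/
  (forall t, t <= l -> zig h (j + t) + t = zig h j).
Proof.
move=> h0 jl.
have e : j %% h = (j %% (2 * h)) %% h by rewrite modn_dvdm// dvdn_mull.
have sh : j %% (2 * h) < 2 * h by rewrite ltn_pmod; lia.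
have [sl|sg] := ltnP (j %% (2 * h)) h; [left|right] => t tl; rewrite /zig.
  rewrite (modn_small sl) in e; rewrite modn_addr; [|lia|lia].
  move: jl; rewrite e; move: (j %% (2 * h)) sl => s sl.
  by clear - sl tl; case: ltnP; lia.
have e2 : j %% h = j %% (2 * h) - h.
  by rewrite e -{1}(subnK sg) modnDr modn_small; lia.
rewrite modn_addr; [|lia|lia].
move: jl; rewrite e2; move: (j %% (2 * h)) sg sh => s sg sh.
by clear - sg sh tl; case: ltnP; lia.
Qed.

(* Between the columns [2 ^ k] and [2 ^ k.+1] the profile is [|i - zig j|], of
   slopes +-1 in both directions; consecutive layers match by [zig_halve]. *)
Definition branch (i j : nat) :=
  if i is 0 then 0 else
  let z := zig (2 ^ (trunc_log 2 i).+1) j in (i - z) + (z - i).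

(** The right end of the layer is included: at [i = 2 ^ k.+1], replacing [z] by [2 * i - z] does not
    change the distance from [i] to [z]. This overlap carries slopes across layers. *)
Lemma branch_layer k i j : 2 ^ k <= i <= 2 ^ k.+1 ->
  branch i j = (i - zig (2 ^ k.+1) j) + (zig (2 ^ k.+1) j - i).
Proof.
have k0 : 0 < 2 ^ k by rewrite expn_gt0.
move=> /andP[ki]; rewrite leq_eqVlt => /predU1P[ik|ik]; last first.
  rewrite /branch; case: i ki ik => [|i] ki ik; first by lia.
  by rewrite (@trunc_log_eq 2 k)// ki.
rewrite ik /branch; case e : (2 ^ k.+1) => [|m]; first by rewrite expnS in e; lia.
rewrite -e trunc_expnK// (@zig_halve (2 ^ k.+1)) ?expn_gt0// -expnS.
have := zig_le (2 ^ k.+2) j; rewrite [2 ^ k.+2]expnS.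
by set z := zig (2 * _) j => zm; clearbody z; clear - zm; lia.
Qed.

Lemma layer_of i : 0 < i -> exists k, 2 ^ k <= i < 2 ^ k.+1.
Proof. by move=> i0; exists (trunc_log 2 i); apply: trunc_log_bounds. Qed.

Lemma branch_lip1 i j :
  branch i.+1 j <= (branch i j).+1 /\ branch i j <= (branch i.+1 j).+1.
Proof.
have [->|i0] := posnP i.
  rewrite (@branch_layer 0 1)// [branch 0 j]/= expn1.
  by have := zig_le 2 j; move: (zig 2 j) => z; lia.
have [k /andP[ki ik]] := layer_of i0.
rewrite !(@branch_layer k); [|lia|lia].
by lia.
Qed.

Lemma branch_lip2 i j :
  branch i j.+1 <= (branch i j).+1 /\ branch i j <= (branch i j.+1).+1.
Proof.
have [->|i0] := posnP i; first by [].
have [k /andP[ki ik]] := layer_of i0.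
rewrite !(@branch_layer k); [|lia|lia].
have : 0 < 2 ^ k.+1 by rewrite expn_gt0.
by move=> /zig_lip-/(_ j); lia.
Qed.

(* [bad] counts the reasons why the window of size [P] at [(i, j)] may meet a
   kink: a change of layer, a kink of [zig], the fold [i = zig j]. *)
Definition fold_near (P h i j : nat) : bool :=
  (i <= zig h j + (2 * P + 1)) && (zig h j <= i + (2 * P + 1)).

Definition bad_layer (P h i j : nat) : nat :=
  (h <= i < h + P) + ((i < h) && (h < j %% h + P.+1)) + fold_near P h i j.

Definition bad (P a b i j : nat) : nat :=
  (i < 2 * P) + \sum_(a <= k < b) bad_layer P (2 ^ k) i j.

Lemma branch_affine (P a b N i j : nat) : 0 < P ->
  a = (trunc_log 2 P).+1 -> b = (trunc_log 2 N).+2 -> i < N ->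
  bad P a b i j = 0 -> 2 * P <= i /\
  exists sg tu : bool, forall x y, i - P <= x <= i.+1 -> j <= y <= j + P.+1 ->
   (x <= i -> if sg then branch x.+1 y = (branch x y).+1
              else branch x y = (branch x.+1 y).+1) /\
   (y <= j + P -> if tu then branch x y.+1 = (branch x y).+1
         else branch x y = (branch x y.+1).+1).
Proof.
move=> P0 aE bE iN /eqP; rewrite addn_eq0 eqb0 -leqNgt => /andP[iP /eqP bad0].
split => //; have i0 : 0 < i - P by lia.
have N0 : 0 < N by lia.
(* The layer of the left end of the window. With [h = 2 ^ k.+1], the excluded case [h <= i < h + P]
   is the only way to leave it. *)
have [k /andP[ki ik]] := layer_of i0.
have ak : a <= k.+1.
  rewrite aE ltnS -ltnS ltnNge; apply/negP => kP.
  have := leq_trans (leq_pexp2l (isT : 0 < 2) kP) (trunc_logP (isT : 1 < 2) P0).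
  by clear - ik iP; lia.
have kb : k.+1 < b by rewrite bE !ltnS; apply: trunc_log_max => //; lia.
have {bad0} : bad_layer P (2 ^ k.+1) i j = 0.
  apply/eqP; rewrite -leqn0 -[leqRHS]bad0 (bigD1_seq k.+1) ?iota_uniq//=.
    exact: leq_addr.
  by rewrite mem_index_iota ak.
have k0 : 0 < 2 ^ k.+1 by rewrite expn_gt0.
have lay x y : i - P <= x <= i.+1 -> i < 2 ^ k.+1 -> branch x y =
    (x - zig (2 ^ k.+1) y) + (zig (2 ^ k.+1) y - x).
  by move=> /andP[ix xi] ih; apply: branch_layer; clear - ix xi ih ki; lia.
move: ki ik k0 lay; move: (2 ^ k.+1) => h ki ik h0 lay /eqP.
rewrite /bad_layer !addn_eq0 !eqb0 => /andP[/andP[b1 b2] b3].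
have ih : i < h.
  by rewrite ltnNge; apply: contra b1 => hi; rewrite hi/=; clear - ik iP P0; lia.
have jh : j %% h + P.+1 <= h by move: b2; rewrite ih/= -leqNgt.
have far : (zig h j + (2 * P + 1) < i) || (i + (2 * P + 1) < zig h j).
  by move: b3; rewrite /fold_near negb_and -!ltnNge.
have {b1 b2 b3 kb ak ki ik}lay' x y := lay x y^~ ih.
case: (zig_affine h0 jh) => zE.
  exists (zig h j < i), (i < zig h j) => x y xi /andP[jy yP].
  have [t tP yE] : exists2 t, t <= P.+1 & y = j + t by exists (y - j); lia.
  split => [xi'|yP'].
    rewrite !lay'; [|lia|lia]; rewrite yE zE//.
    by clear - far xi xi' tP; case: ltnP; lia.
  rewrite !lay'; [|lia|lia]; rewrite yE -addnS !zE//; [|lia].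
  by clear - far xi tP; case: ltnP; lia.
exists (zig h j < i), (zig h j < i) => x y xi /andP[jy yP].
have [t tP yE] : exists2 t, t <= P.+1 & y = j + t by exists (y - j); lia.
have zt := zE t tP.
split => [xi'|yP'].
  rewrite !lay'; [|lia|lia]; rewrite yE.
  by move: (zig h (j + t)) zt => zt' zt; clear - far xi xi' tP zt; case: ltnP; lia.
have zt1 := zE t.+1 ltac:(lia).
rewrite !lay'; [|lia|lia]; rewrite yE -addnS.
move: (zig h (j + t)) (zig h (j + t.+1)) zt zt1 => zt' zt1' zt zt1.
by clear - P0 far xi zt zt1 yP' yE; case: ltnP; lia.
Qed.

Lemma count_interval (N a b : nat) : \sum_(0 <= i < N) (a <= i < b) <= b - a.
Proof.
have [ab|ba] := leqP a b; last first.
  rewrite big1 ?leq0n// => i _; apply/eqP; rewrite eqb0; apply/negP => /andP[ai ib].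
  by lia.
suff -> : \sum_(0 <= i < N) (a <= i < b) = minn N b - minn N a by lia.
elim: N => [|N IH]; first by rewrite big_geq//; lia.
by rewrite big_nat_recr//= IH; case: leqP; case: ltnP => /=; lia.
Qed.

Lemma count_mod (N h l : nat) : 0 < h ->
  \sum_(0 <= j < N) (h < j %% h + l) <= (N %/ h + 1) * l.
Proof.
move=> h0; apply: (@leq_trans (\sum_(0 <= j < (N %/ h + 1) * h) (h < j %% h + l))).
  have Nh : N <= (N %/ h + 1) * h by rewrite addn1 ltnW// ltn_ceil.
  by rewrite [leqRHS](@big_cat_nat _ _ _ N)//= leq_addr.
rewrite big_nat_mul.
apply: (@leq_trans (\sum_(0 <= i < N %/ h + 1) l)); last first.
  by rewrite sum_nat_const_nat subn0.
apply: leq_sum => i _; rewrite -[X in \sum_(X <= _ < _) _]add0n big_addn mulSn addnK.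
apply: (@leq_trans (\sum_(0 <= t < h) (h.+1 - l <= t < h))).
  rewrite !big_nat; apply: leq_sum => t /andP[_ th].
  rewrite [t + i * h]addnC modnMDl modn_small//.
  by case: (ltnP h) => //= hl; rewrite th andbT lt0b; lia.
by apply: leq_trans (count_interval _ _ _) _; lia.
Qed.

(** The bound does not depend on [h]: a layer has about [N / h + 1] kinks of [zig], each of length
    [h], besides one change of layer and one fold per row. The contributions are [P * N],
    [6 * P * N] and [7 * P * N]. *)
Lemma count_bad_layer (P h N : nat) : 0 < P -> 0 < h -> h <= 2 * N ->
  \sum_(0 <= j < N) \sum_(0 <= i < N) bad_layer P h i j <= 14 * P * N.
Proof.
move=> P0 h0 hN.
have -> : \sum_(0 <= j < N) \sum_(0 <= i < N) bad_layer P h i j =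
  \sum_(0 <= j < N) \sum_(0 <= i < N) (h <= i < h + P) +
  (\sum_(0 <= j < N) (h < j %% h + P.+1)) * (\sum_(0 <= i < N) (i < h)) +
  \sum_(0 <= j < N) \sum_(0 <= i < N) fold_near P h i j.
  rewrite big_distrl/= -!big_split/=; apply: eq_bigr => j _.
  rewrite big_distrr/= -!big_split/=; apply: eq_bigr => i _.
  by rewrite /bad_layer; congr (_ + _ + _); rewrite mulnb andbC.
have s1 : \sum_(0 <= j < N) \sum_(0 <= i < N) (h <= i < h + P) <= N * P.
  apply: (@leq_trans (\sum_(0 <= j < N) P)).
    by apply: leq_sum => j _; apply: leq_trans (count_interval _ _ _) _; lia.
  by rewrite sum_nat_const_nat subn0.
have s2 : \sum_(0 <= i < N) (i < h) <= h.
  by have := count_interval N 0 h; rewrite subn0.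
have s3 := @count_mod N h P.+1 h0.
have s4 : \sum_(0 <= j < N) \sum_(0 <= i < N) fold_near P h i j <= N * (4 * P + 3).
  apply: (@leq_trans (\sum_(0 <= j < N) (4 * P + 3))); last first.
    by rewrite sum_nat_const_nat subn0.
  apply: leq_sum => j _.
  apply: leq_trans (leq_trans (count_interval N (zig h j - (2 * P + 1))
     (zig h j + (2 * P + 2))) _); last by lia.
  apply: leq_sum => i _; rewrite /fold_near; case: andP => //= -[h1 h2].
  by rewrite (_ : _ <= _ < _)//; apply/andP; split; lia.
have Nh : N %/ h * h <= N := leq_trunc_div N h.
have : (\sum_(0 <= j < N) (h < j %% h + P.+1)) * (\sum_(0 <= i < N) (i < h))
    <= (N %/ h + 1) * P.+1 * h by exact: leq_mul.
move: s1 s4; do 4 move: (\sum_(0 <= j < N) _) => ?.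
move: (N %/ h) Nh => q Nh; clear - P0 hN Nh => s1 s4 s5.
have : (q + 1) * P.+1 * h <= 3 * N * (2 * P) by nia.
nia.
Qed.

Lemma count_bad (P a b N : nat) : 0 < P -> b <= (trunc_log 2 N).+2 -> 0 < N ->
  \sum_(0 <= j < N) \sum_(0 <= i < N) bad P a b i j
    <= (2 + 14 * (b - a)) * (P * N).
Proof.
move=> P0 bN N0; under eq_bigr do rewrite big_split/=.
rewrite big_split/= mulnDl; apply: leq_add.
  apply: (@leq_trans (\sum_(0 <= j < N) 2 * P)).
    by apply: leq_sum => j _; have := count_interval N 0 (2 * P); rewrite subn0.
  by rewrite sum_nat_const_nat subn0; lia.
under eq_bigr do rewrite exchange_big/=.
rewrite exchange_big/= -mulnA mulnCA.
apply: (@leq_trans (\sum_(a <= k < b) 14 * P * N)); last first.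
  by rewrite sum_nat_const_nat; lia.
rewrite !big_nat; apply: leq_sum => k /andP[_ kb].
apply: count_bad_layer; rewrite ?expn_gt0//.
have : k <= (trunc_log 2 N).+1 by rewrite -ltnS (leq_trans kb).
move=> /(leq_pexp2l (isT : 0 < 2))/leq_trans; apply.
by rewrite expnS leq_mul2l trunc_logP.
Qed.

End Zigzag.

(** * Mollified profile *)

Section Mollify.
Variable R : realType.
Implicit Types (W : nat -> nat -> R) (th q r : R).

(** [th] is the increment of the free helix; [th ^ 2 / 8 <= 1 - cos th = r ^ 2] bounds it. *)
Lemma helix_angle r : 0 < r < 1 ->
  exists th, [/\ 0 <= th <= pi / 2, cos th = 1 - r ^+ 2 & th <= 3 * r].
Proof.
move=> /andP[r0 r1].
have c1 : -1 <= 1 - r ^+ 2 <= 1 by apply/andP; split; nra.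
have ce : cos (acos (1 - r ^+ 2)) = 1 - r ^+ 2 by rewrite acosK// in_itv.
have t0 := acos_ge0 c1; have tpi := acos_lepi c1.
have p0 := pi_gt0 R.
have t2 : acos (1 - r ^+ 2) <= pi / 2.
  rewrite leNgt; apply/negP; rewrite -ltr_cos ?in_itv/=; last 2 first.
  - by apply/andP; split; lra.
  - by rewrite t0.
  by rewrite ce cos_pihalf; nra.
exists (acos (1 - r ^+ 2)); split => //; first by rewrite t0.
have := @one_sub_cos_ge _ (acos (1 - r ^+ 2)); rewrite ger0_norm// ce => /(_ t2) h.
by nra.
Qed.

Lemma cos_ge_of_le q th : `|q| <= th -> th <= pi -> cos th <= cos q.
Proof.
move=> qth thpi.
have -> : cos q = cos `|q|.
  by have [q0|q0] := leP 0 q; [rewrite ger0_norm|rewrite ltr0_norm// cosN].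
rewrite leNgt; apply/negP; rewrite ltr_cos ?in_itv/= ?normr_ge0 ?(le_trans qth)//.
  by rewrite ltNge qth.
by rewrite (le_trans _ qth)//=.
Qed.

(** Increments of size at most [th] have cosines between [1 - r ^ 2] and 1, which bounds the first
    square; the second is bounded by the second difference since the sine is 1-Lipschitz. *)
Lemma dens_expi_le r th d (x y z : R) : 0 <= th <= pi / 2 -> cos th = 1 - r ^+ 2 ->
  `|y - x| <= th -> `|z - y| <= th -> `|z - 2 * y + x| <= d ->
  dens (r ^+ 2) (expi x) (expi y) (expi z) <= 4 * r ^+ 4 + d ^+ 2.
Proof.
move=> /andP[t0 tpi] ct h1 h2 h3; rewrite dens_expi.
have tp : th <= pi by have := pi_gt0 R; lra.
have c1 := cos_ge_of_le h1 tp; have c2 := cos_ge_of_le h2 tp.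
have c3 := cos_le1 (y - x); have c4 := cos_le1 (z - y).
apply: lerD.
  have -> : 4 * r ^+ 4 = (2 * r ^+ 2) ^+ 2 by ring.
  have r2 : 0 <= 2 * r ^+ 2 by rewrite pmulr_rge0// sqr_ge0.
  rewrite -[leLHS]real_normK ?num_real// ler_sqr ?nnegrE//.
  by rewrite ler_norml; apply/andP; split; lra.
have d0 : 0 <= d := le_trans (normr_ge0 _) h3.
rewrite -[leLHS]real_normK ?num_real// ler_sqr ?nnegrE//.
apply: le_trans h3; have e : z - 2 * y + x = (z - y) - (y - x) by ring.
rewrite e; have [h|/ltW h] := leP (y - x) (z - y).
  by rewrite (ger0_norm (_ : 0 <= z - y - _)) ?subr_ge0// sin_sub_le.
by rewrite distrC [leRHS]distrC (ger0_norm (_ : 0 <= y - x - _)) ?subr_ge0// sin_sub_le.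
Qed.

Lemma dens_expi_helix r th (x y z : R) (sg : bool) : cos th = 1 - r ^+ 2 ->
  y - x = (-1) ^+ sg * th -> z - y = (-1) ^+ sg * th ->
  dens (r ^+ 2) (expi x) (expi y) (expi z) = 0.
Proof.
move=> ct -h1 h2; rewrite dens_expi h1 h2.
have -> : cos ((-1) ^+ sg * th) = 1 - r ^+ 2.
  by case: sg {h1 h2}; rewrite ?expr1 ?expr0 ?mulN1r ?cosN ?mul1r.
ring.
Qed.

Definition moll th (P : nat) W i j : R := th / P%:R ^+ 2 *
  \sum_(0 <= a < P) \sum_(0 <= b < P) W (i + a)%N (j + b)%N.

Lemma moll_tr th P W i j : moll th P W i j = moll th P (fun y x => W x y) j i.
Proof. by rewrite /moll exchange_big. Qed.

Variables (th : R) (P : nat).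
Hypothesis th0 : 0 <= th.
Hypothesis P0 : (0 < P)%N.

Let P0' : 0 < P%:R :> R. Proof. by rewrite ltr0n. Qed.

Let sum2_const c : \sum_(0 <= a < P) \sum_(0 <= b < P) c = P%:R ^+ 2 * c :> R.
Proof.
under eq_bigr do rewrite sumr_const_nat subn0.
by rewrite sumr_const_nat subn0 -mulrnA -[LHS]mulr_natl natrM expr2.
Qed.

Let sum2_le (F : nat -> nat -> R) c :
  (forall a b, (a < P)%N -> (b < P)%N -> `|F a b| <= c) ->
  `|\sum_(0 <= a < P) \sum_(0 <= b < P) F a b| <= P%:R ^+ 2 * c.
Proof.
move=> Fc; rewrite -sum2_const.
apply: le_trans (ler_norm_sum _ _ _) _.
rewrite !big_nat; apply: ler_sum => a /andP[_ aP].
apply: le_trans (ler_norm_sum _ _ _) _.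
by rewrite !big_nat; apply: ler_sum => b /andP[_ bP]; exact: Fc.
Qed.

Lemma moll_sub W i j : moll th P W i.+1 j - moll th P W i j = th / P%:R ^+ 2 *
  \sum_(0 <= a < P) \sum_(0 <= b < P)
     (W (i + a).+1 (j + b)%N - W (i + a)%N (j + b)%N).
Proof.
rewrite /moll -mulrBr -sumrB; congr (_ * _); apply: eq_bigr => a _.
by rewrite -sumrB; apply: eq_bigr => b _; rewrite addSn.
Qed.

Lemma moll_lip W i j : (forall x y, `|W x.+1 y - W x y| <= 1) ->
  `|moll th P W i.+1 j - moll th P W i j| <= th.
Proof.
move=> Wlip; rewrite moll_sub normrM.
rewrite ger0_norm ?divr_ge0 ?sqr_ge0//.
apply: (@le_trans _ _ (th / P%:R ^+ 2 * (P%:R ^+ 2 * 1))).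
  by rewrite ler_wpM2l ?divr_ge0 ?sqr_ge0//; apply: sum2_le.
by rewrite mulr1 divfK// sqrf_eq0 gt_eqF.
Qed.

(** Summation over the window telescopes in the first variable; of its [P ^ 2] terms only the two
    extreme columns remain, which gains a factor [1 / P]. *)
Lemma moll_snd W i j : (forall x y, `|W x.+1 y - W x y| <= 1) ->
  `|moll th P W i.+2 j - 2 * moll th P W i.+1 j + moll th P W i j| <= 2 * th / P%:R.
Proof.
move=> Wlip.
have -> : moll th P W i.+2 j - 2 * moll th P W i.+1 j + moll th P W i j =
  th / P%:R ^+ 2 * \sum_(0 <= b < P)
   ((W (i + P).+1 (j + b)%N - W (i + P)%N (j + b)%N) -
    (W i.+1 (j + b)%N - W i (j + b)%N)).
  transitivity ((moll th P W i.+2 j - moll th P W i.+1 j)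
     - (moll th P W i.+1 j - moll th P W i j)); first by ring.
  rewrite !moll_sub -mulrBr -sumrB; congr (_ * _).
  under eq_bigr do rewrite -sumrB; rewrite exchange_big/=.
  apply: eq_bigr => b _.
  pose g a := W (i + a)%N.+1 (j + b)%N - W (i + a)%N (j + b)%N.
  transitivity (g P - g 0%N); last by rewrite /g addn0.
  rewrite -(telescope_sumr g (leq0n P)); apply: eq_bigr => k _.
  by rewrite /g addSn addnS.
rewrite normrM ger0_norm ?divr_ge0 ?sqr_ge0//.
have -> : 2 * th / P%:R = th / P%:R ^+ 2 * (\sum_(0 <= b < P) 2).
  by rewrite sumr_const_nat subn0 -mulr_natl; field; rewrite gt_eqF.
rewrite ler_wpM2l ?divr_ge0 ?sqr_ge0//.
apply: le_trans (ler_norm_sum _ _ _) _; apply: ler_sum => b _.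
by apply: le_trans (ler_normB _ _) _; have := Wlip (i + P)%N (j + b)%N;
  have := Wlip i (j + b)%N; lra.
Qed.

Lemma moll_slope W i j c : (forall a b, (a < P)%N -> (b < P)%N ->
    W (i + a).+1 (j + b)%N - W (i + a)%N (j + b)%N = c) ->
  moll th P W i.+1 j - moll th P W i j = c * th.
Proof.
move=> Wc; rewrite moll_sub.
have -> : \sum_(0 <= a < P) \sum_(0 <= b < P)
     (W (i + a).+1 (j + b)%N - W (i + a)%N (j + b)%N) = P%:R ^+ 2 * c.
  rewrite -sum2_const.
  by apply: eq_big_nat => a /andP[_ aP]; apply: eq_big_nat => b /andP[_ bP]; exact: Wc.
by field; rewrite gt_eqF.
Qed.

(** * Energy of the averaged branching profile *)

Variables (r : R) (N : nat).
Hypothesis r0 : 0 < r.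
Hypothesis thr : th <= 3 * r.
Hypothesis thpi : th <= pi / 2.
Hypothesis cth : cos th = 1 - r ^+ 2.
Hypothesis rP : 1 <= P%:R * r.

(** With this shift (truncated subtraction) the window at column 0 meets only zeros, so averaging
    preserves the boundary condition. *)
Let W x y : R := (branch (x - P) y)%:R.

Let natdist (m n : nat) : (m <= n.+1)%N -> (n <= m.+1)%N -> `|m%:R - n%:R| <= 1 :> R.
Proof.
rewrite -(ler_nat R) -[n.+1%:R]natr1 => h; rewrite -(ler_nat R) -[m.+1%:R]natr1 => h'.
by rewrite ler_norml; apply/andP; split; lra.
Qed.

Let W1 x y : `|W x.+1 y - W x y| <= 1.
Proof.
rewrite /W; have [Px|xP] := leqP P x.
  by rewrite subSn//; have [] := branch_lip1 (x - P) y; exact: natdist.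
have -> : (x.+1 - P = x - P)%N by clear - xP; lia.
by rewrite subrr normr0.
Qed.

Let W2 x y : `|W x y.+1 - W x y| <= 1.
Proof. by rewrite /W; have [] := branch_lip2 (x - P) y; exact: natdist. Qed.

Definition branch_angle i j := moll th P W i j.

Lemma branch_angle0 j : branch_angle 0 j = 0.
Proof.
rewrite /branch_angle /moll big1_seq ?mulr0// => a /andP[_].
rewrite mem_index_iota => /andP[_ aP]; rewrite big1// => b _.
by rewrite /W add0n (_ : (a - P = 0)%N)//; apply/eqP; rewrite subn_eq0 ltnW.
Qed.

(** Since [1 / P <= r], the second difference is at most [6 * r ^ 2], and [4 + 36 = 40]. *)
Let dens_bad (x y z : R) :
  `|y - x| <= th -> `|z - y| <= th -> `|z - 2 * y + x| <= 2 * th / P%:R ->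
  dens (r ^+ 2) (expi x) (expi y) (expi z) <= 40 * r ^+ 4.
Proof.
move=> h1 h2 h3; have ht : 0 <= th <= pi / 2 by rewrite th0.
apply: le_trans (dens_expi_le ht cth h1 h2 h3) _.
have : 2 * th / P%:R <= 6 * r ^+ 2.
  rewrite ler_pdivrMr//; have t1 := thr; have t2 := r0; have t3 := rP; nra.
have : 0 <= 2 * th / P%:R by rewrite divr_ge0 ?mulr_ge0.
have := sqr_ge0 r; rewrite (_ : r ^+ 4 = (r ^+ 2) ^+ 2); last by ring.
by nra.
Qed.

Let a := (trunc_log 2 P).+1.
Let b := (trunc_log 2 N).+2.

Let slopeE (sg : bool) (m n : nat) :
  (if sg then m = n.+1 else n = m.+1) -> m%:R - n%:R = (-1) ^+ (~~ sg) :> R.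
Proof.
by case: sg => ->; rewrite -natr1 /= ?expr0 ?expr1; ring.
Qed.

(** The three averages see only the columns [i - P] to [i.+1] of [branch], the range of
    [branch_affine]. Either that window is affine and the triple lies on a free helix, or [bad] is
    at least 1 and [dens_bad] suffices. *)
Lemma branch_dens_hor i j : (i < N)%N ->
  dens (r ^+ 2) (expi (branch_angle i j)) (expi (branch_angle i.+1 j))
    (expi (branch_angle i.+2 j)) <= 40 * r ^+ 4 * (bad P a b i j)%:R.
Proof.
move=> iN; have [bad0|badn] := posnP (bad P a b i j); last first.
  apply: (@le_trans _ _ (40 * r ^+ 4)).
    by apply: dens_bad; [exact: moll_lip|exact: moll_lip|exact: moll_snd].
  by rewrite ler_peMr ?ler1n// mulr_ge0// exprn_ge0// ltW.
have [iP [sg [tu aff]]] := branch_affine P0 erefl erefl iN bad0.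
rewrite bad0 mulr0 (@dens_expi_helix r th _ _ _ (~~ sg))//; apply: moll_slope => a' b' aP bP.
  rewrite /W subSn; [apply: slopeE|clear - iP; lia].
  by have [h _] := aff (i + a' - P)%N (j + b')%N
    ltac:(clear - iP aP; lia) ltac:(clear - bP; lia);
    apply: h; clear - iP aP; lia.
rewrite /W subSn; [apply: slopeE|clear - iP; lia].
by have [h _] := aff (i.+1 + a' - P)%N (j + b')%N
    ltac:(clear - iP aP; lia) ltac:(clear - bP; lia);
    apply: h; clear - iP aP; lia.
Qed.

Lemma branch_dens_ver i j : (i < N)%N ->
  dens (r ^+ 2) (expi (branch_angle i j)) (expi (branch_angle i j.+1))
    (expi (branch_angle i j.+2)) <= 40 * r ^+ 4 * (bad P a b i j)%:R.
Proof.
move=> iN; have [bad0|badn] := posnP (bad P a b i j); last first.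
  apply: (@le_trans _ _ (40 * r ^+ 4)).
    rewrite /branch_angle !(moll_tr th P W).
    by apply: dens_bad; [apply: moll_lip|apply: moll_lip|apply: moll_snd] => *; exact: W2.
  by rewrite ler_peMr ?ler1n// mulr_ge0// exprn_ge0// ltW.
have [iP [sg [tu aff]]] := branch_affine P0 erefl erefl iN bad0.
rewrite /branch_angle !(moll_tr th P W).
rewrite bad0 mulr0 (@dens_expi_helix r th _ _ _ (~~ tu))//; apply: moll_slope => b' a' bP aP.
  rewrite /W; apply: slopeE.
  by have [_ h] := aff (i + a' - P)%N (j + b')%N
    ltac:(clear - iP aP; lia) ltac:(clear - bP; lia);
    apply: h; clear - bP; lia.
rewrite /W; apply: slopeE.
by have [_ h] := aff (i + a' - P)%N (j.+1 + b')%N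
    ltac:(clear - iP aP; lia) ltac:(clear - bP; lia);
    apply: h; clear - bP; lia.
Qed.

Lemma branch_energy : (0 < N)%N ->
  grid_energy N (r ^+ 2) (fun i j => expi (branch_angle i j))
    <= 80 * r ^+ 4 * ((2 + 14 * (b - a)) * (P * N))%:R.
Proof.
move=> N0; have cnt := @count_bad P a b N P0 (leqnn _) N0.
have r4 : 0 <= 40 * r ^+ 4 by rewrite mulr_ge0// exprn_ge0// ltW.
pose S : R := \sum_(0 <= j < N) \sum_(0 <= i < N) 40 * r ^+ 4 * (bad P a b i j)%:R.
have SE : S = 40 * r ^+ 4 * (\sum_(0 <= j < N) \sum_(0 <= i < N) bad P a b i j)%:R.
  rewrite /S natr_sum mulr_sumr; apply: eq_bigr => j _.
  by rewrite natr_sum mulr_sumr.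
have bad_ge0 i j : 0 <= 40 * r ^+ 4 * (bad P a b i j)%:R by rewrite mulr_ge0.
have N2 : (N.-2 <= N)%N by clear; lia.
apply: (@le_trans _ _ (S + S)).
  rewrite /grid_energy lerD//.
    apply: ler_sum => j _.
    apply: le_trans (@sum_nat_sub_le _ _ 0 N.-2 N (fun i => bad_ge0 i j) N2).
    by rewrite !big_nat; apply: ler_sum => i /andP[_ iN];
      apply: branch_dens_hor; clear - iN; lia.
  rewrite /S [leRHS]exchange_big/= !big_nat; apply: ler_sum => i /andP[_ iN].
  apply: le_trans (@sum_nat_sub_le _ _ 0 N.-2 N (fun j => bad_ge0 i j) N2).
  by apply: ler_sum => j _; apply: branch_dens_ver.
have -> : 80 * r ^+ 4 * ((2 + 14 * (b - a)) * (P * N))%:R =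
  40 * r ^+ 4 * ((2 + 14 * (b - a)) * (P * N))%:R +
  40 * r ^+ 4 * ((2 + 14 * (b - a)) * (P * N))%:R by ring.
by rewrite SE lerD// ler_wpM2l// ler_nat.
Qed.

End Mollify.

(** * Logarithmic upper bound *)

Section UpperLog.
Variable R : realType.
Implicit Types (eps r : R).

Lemma upper_const eps delta (N : nat) : 0 < eps -> N%:R * eps <= 3 / 2 ->
  exists2 v, admissible v &
    eps ^+ 2 / 2 * grid_energy N delta v <= 9 * delta ^+ 2.
Proof.
move=> e0 Ne; exists (fun _ _ => (1, 0)).
  by split => // i j; rewrite /unit_vec expr1n expr0n addr0.
have N2 : (N.-2 <= N)%N by lia.
have hN : \sum_(0 <= j < N) \sum_(0 <= i < N.-2) (4 * delta ^+ 2)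
    <= N%:R ^+ 2 * (4 * delta ^+ 2) :> R.
  under eq_bigr do rewrite sumr_const_nat subn0.
  rewrite sumr_const_nat subn0 -mulrnA -[leLHS]mulr_natl ler_wpM2r//.
    by rewrite pmulr_rge0// sqr_ge0.
  by rewrite expr2 -natrM ler_nat leq_mul2r N2 orbT.
have e : dens delta (1, 0) (1, 0) (1, 0) = 4 * delta ^+ 2 by rewrite /dens/=; ring.
set M := \sum_(0 <= j < N) _ in hN.
have -> : grid_energy N delta (fun _ _ => (1, 0)) = M + M.
  by congr (_ + _); apply: eq_bigr => ? _; apply: eq_bigr => ? _; exact: e.
have Ne0 : 0 <= N%:R * eps by rewrite mulr_ge0// ltW.
have e2 : 0 <= eps ^+ 2 / 2 by rewrite divr_ge0// sqr_ge0.
apply: (le_trans (ler_wpM2l e2 (lerD hN hN))).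
have -> : eps ^+ 2 / 2 * (N%:R ^+ 2 * (4 * delta ^+ 2) + N%:R ^+ 2 * (4 * delta ^+ 2))
   = 4 * (N%:R * eps) ^+ 2 * delta ^+ 2 by field.
by rewrite ler_wpM2r ?sqr_ge0//; clear - Ne Ne0; nra.
Qed.

(** Counts the dyadic layers between [P] and [N]: [2 ^ k * P <= 2 * N], and [ln 2] lies between
    [1 / 2] and 1. *)
Lemma log_layers (P N : nat) : (0 < P <= N)%N ->
  ((trunc_log 2 N).+2 - (trunc_log 2 P).+1)%:R <= 3 + 2 * ln (N%:R / P%:R) :> R.
Proof.
move=> /andP[P0 PN]; have N0 := leq_trans P0 PN.
have P0' : 0 < P%:R :> R by rewrite ltr0n.
have N0' : 0 < N%:R :> R by rewrite ltr0n.
have tPN : (trunc_log 2 P <= trunc_log 2 N)%N by apply: leq_trunc_log.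
set k := (trunc_log 2 N - trunc_log 2 P)%N.
have -> : ((trunc_log 2 N).+2 - (trunc_log 2 P).+1)%N = k.+1.
  by rewrite subSS subSn.
have kP : (2 ^ k * P <= 2 * N)%N.
  apply: (@leq_trans (2 ^ k * 2 ^ (trunc_log 2 P).+1)).
    by rewrite leq_mul2l ltnW ?orbT// trunc_log_ltn.
  by rewrite -expnD /k addnS subnK// expnS leq_mul2l trunc_logP.
have : ln (2 ^+ k) <= ln (2 * (N%:R / P%:R)) :> R.
  rewrite ler_ln ?posrE ?exprn_gt0 ?mulr_gt0 ?invr_gt0//.
  by rewrite mulrA ler_pdivlMr// -natrX -!natrM ler_nat.
rewrite lnXn// lnM ?posrE ?divr_gt0// -[_ *+ k]mulr_natl.
have l2 : ln 2 <= 1 :> R.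
  have : ln (1 + 1) <= 1 :> R by apply: le_ln1Dx; lra.
  by rewrite (_ : 1 + 1 = 2)//; ring.
have l1 := half_le_ln2 R; have k0 : 0 <= k%:R :> R by [].
rewrite -[k.+1%:R]natr1; set L := ln (_ / _); set l := ln 2 in l1 l2 *.
move=> h; have h1 : k%:R * (1 / 2) <= k%:R * l by rewrite ler_wpM2l.
by clearbody l L; clear - l1 l2 h h1; lra.
Qed.

Lemma transition_width r : 0 < r < 1 -> exists P : nat,
  [/\ (0 < P)%N, 1 <= P%:R * r, P%:R * r <= 2 & P.-1%:R * r <= 1].
Proof.
move=> /andP[r0 r1]; exists (Num.truncn r^-1).+1.
have /andP[Pr rP] : (Num.truncn r^-1)%:R <= r^-1 < (Num.truncn r^-1).+1%:R.
  by apply: truncn_itv; rewrite invr_ge0 ltW.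
have P1 : (Num.truncn r^-1)%:R * r <= 1 by rewrite -ler_pdivlMr// div1r.
split => //; first by rewrite -ler_pdivrMr// div1r ltW.
have -> : (Num.truncn r^-1).+1%:R = (Num.truncn r^-1)%:R + 1 :> R by rewrite natr1.
by clear - r1 P1; lra.
Qed.

Lemma upper_log eps r (N : nat) : 0 < eps < r -> r < 1 ->
  1 <= N%:R * eps -> N%:R * eps <= 3 / 2 ->
  exists2 v, admissible v &
    eps ^+ 2 / 2 * grid_energy N (r ^+ 2) v
      <= 120 * 58 * log_scaling eps (r ^+ 2).
Proof.
move=> /andP[e0 er] r1 Ne1 Ne; have r0 : 0 < r := lt_trans e0 er.
have hr : 0 < r < 1 by rewrite r0.
have [th [/andP[th0 thpi] cth thr]] := helix_angle hr.
have [P [P0 rP1 rP2 rP]] := transition_width hr.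
have P0' : 0 < P%:R :> R by rewrite ltr0n.
have N0' : 0 < N%:R :> R.
  by rewrite -(pmulr_lgt0 _ e0) (lt_le_trans _ Ne1).
have N0 : (0 < N)%N by rewrite -(ltr0n R).
have PN : (P <= N)%N.
  rewrite -(prednK P0) -(ltr_nat R) -(ltr_pM2r r0); apply: (le_lt_trans rP).
  by apply: (le_lt_trans Ne1); rewrite ltr_pM2l.
exists (fun i j => expi (branch_angle th P i j)).
  split => [i j|j]; first exact: unit_vec_expi.
  by rewrite branch_angle0 /expi cos0 sin0.
have e2 : 0 <= eps ^+ 2 / 2 by rewrite divr_ge0// sqr_ge0.
apply: le_trans (ler_wpM2l e2 (branch_energy th0 P0 r0 thr thpi cth rP1 N0)) _.
have hPN : (0 < P <= N)%N by rewrite P0.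
have := log_layers hPN; set B := (_ - _)%N => hB.
have er0 : 0 < r / eps by rewrite divr_gt0.
have lnNP : ln (N%:R / P%:R) <= 1 / 2 + ln (r / eps).
  have l32 : ln (1 + 1 / 2) <= 1 / 2 :> R by apply: le_ln1Dx; lra.
  have p32 : 0 < 1 + 1 / 2 :> R by lra.
  have : ln (N%:R / P%:R) <= ln ((1 + 1 / 2) * (r / eps)).
    rewrite ler_ln ?posrE ?divr_gt0 ?mulr_gt0 ?invr_gt0//.
    rewrite ler_pdivrMr// mulrA mulrAC ler_pdivlMr//.
    by clear - rP1 Ne; nra.
  by rewrite [ln (_ * (r / eps))]lnM ?posrE//; clear - l32; lra.
have lner : `|ln (eps / r)| = ln (r / eps).
  rewrite ler0_norm; last by rewrite ln_le0// ler_pdivrMr// mul1r ltW.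
  by rewrite -lnV ?posrE ?divr_gt0// invf_div.
have ler0 : 0 <= ln (r / eps) by rewrite ln_ge0// ler_pdivlMr// mul1r ltW.
rewrite log_scalingE// lner !natrM natrD natrM.
set L := ln (r / eps) in lnNP ler0 *; set l := ln (_ / _) in lnNP hB.
have er3 : 0 < eps * r ^+ 3 by rewrite mulr_gt0// exprn_gt0.
have -> : eps ^+ 2 / 2 * (80 * r ^+ 4 * ((2%:R + 14%:R * B%:R) * (P%:R * N%:R))) =
  eps * r ^+ 3 * (40 * ((2%:R + 14%:R * B%:R) * ((P%:R * r) * (N%:R * eps)))) by field.
rewrite [leRHS]mulrCA ler_pM2l//.
(* From [P * r <= 2] and [N * eps <= 3 / 2]. With [40 * 3 = 120] and the 58 from the number of
   layers this is the constant of the statement. *)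
have PN3 : (P%:R * r) * (N%:R * eps) <= 3.
  have : 0 <= P%:R * r by apply: le_trans rP1.
  by clear - rP2 Ne Ne1; nra.
have BL : 2%:R + 14%:R * B%:R <= 58 * (L + 1).
  by clearbody l L; clear - hB lnNP ler0; lra.
have B0 : 0 <= 2%:R + 14%:R * B%:R :> R by rewrite addr_ge0// mulr_ge0.
have -> : 120 * 58 * (L + 1) = 40 * ((58 * (L + 1)) * 3) by ring.
rewrite ler_pM2l// ler_pM//.
by rewrite mulr_ge0 ?(le_trans _ rP1) ?(le_trans _ Ne1).
Qed.

End UpperLog.

(** * Vortices *)

Section Vortex.
Variable R : realType.
Implicit Types (x y : R) (a b g : R * R).

(** The sum telescopes against [4 * f] with [f t = t / (1 + |t|)], an algebraic substitute for the
    arctangent, with values between -1 and 1. *)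
Lemma sum_cauchy_le (M : nat) x :
  \sum_(0 <= j < M) (1 + (j%:R - x) ^+ 2)^-1 <= 8.
Proof.
pose f (t : R) := t / (1 + `|t|).
have fle t : `|f t| <= 1.
  have p : 0 < 1 + `|t| by rewrite ltr_pwDl.
  by rewrite normrM normfV (gtr0_norm p) ler_pdivrMr// mul1r lerDr.
have step t : (1 + t ^+ 2)^-1 <= 4 * (f (t + 1) - f t).
  have p : 0 < 1 + t ^+ 2 by rewrite ltr_pwDl// sqr_ge0.
  rewrite -[leLHS]mul1r ler_pdivrMr// /f.
  have [t0|t0] := leP 0 t.
    rewrite (ger0_norm t0) ger0_norm ?addr_ge0//.
    have -> : 4 * ((t + 1) / (1 + (t + 1)) - t / (1 + t)) * (1 + t ^+ 2) =
      4 * (1 + t ^+ 2) / ((1 + t) * (1 + (t + 1))).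
      by field; apply/andP; split; rewrite gt_eqF//; lra.
    have q : 0 < (1 + t) * (1 + (t + 1)) by rewrite mulr_gt0//; lra.
    by rewrite ler_pdivlMr// mul1r; nra.
  rewrite (ltr0_norm t0); have [t1|t1] := leP t (-1).
    rewrite ler0_norm; last by lra.
    have -> : 4 * ((t + 1) / (1 - (t + 1)) - t / (1 - t)) * (1 + t ^+ 2) =
      4 * (1 + t ^+ 2) / (- t * (1 - t)).
      by field; apply/and3P; split; [rewrite gt_eqF//; lra|rewrite lt_eqF|rewrite gt_eqF//; lra].
    have q : 0 < - t * (1 - t) by rewrite mulr_gt0//; lra.
    by rewrite ler_pdivlMr// mul1r; nra.
  rewrite ger0_norm; last by lra.
  have h1 : (t + 1) / 2 <= (t + 1) / (1 + (t + 1)).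
    have q : 0 < 1 + (t + 1) by lra.
    by rewrite ler_pdivlMr//; nra.
  have h2 : - t / 2 <= - (t / (1 - t)).
    have q : 0 < 1 - t by lra.
    by rewrite -mulNr ler_pdivlMr//; nra.
  by have := sqr_ge0 t; nra.
apply: (@le_trans _ _ (\sum_(0 <= j < M) (4 * f (j.+1%:R - x) - 4 * f (j%:R - x)))).
  apply: ler_sum => j _; apply: le_trans (step _) _.
  rewrite mulrBr (_ : j%:R - x + 1 = j.+1%:R - x)//.
  by rewrite -[j.+1%:R in RHS]natr1; ring.
rewrite (telescope_sumr (fun j => 4 * f (j%:R - x)))//.
have := fle (M%:R - x); have := fle (0%:R - x).
by rewrite !ler_norml => /andP[? ?] /andP[? ?]; lra.
Qed.

Definition nsq a := a.1 ^+ 2 + a.2 ^+ 2.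

(* [a / conj a] for [a] read as a complex number, which avoids the square root
   in [a / |a|]; vortices sit at the zeros of [a]. *)
Definition dir a : R * R := if nsq a == 0 then (1, 0)
  else ((a.1 ^+ 2 - a.2 ^+ 2) / nsq a, 2 * a.1 * a.2 / nsq a).

Lemma nsq_ge0 a : 0 <= nsq a.
Proof. by rewrite addr_ge0 ?sqr_ge0. Qed.

Lemma unit_vec_dir a : unit_vec (dir a).
Proof.
rewrite /dir /unit_vec; case: eqP => [_|/eqP n0] /=.
  by rewrite expr1n expr0n addr0.
by rewrite /nsq in n0 *; field.
Qed.

Definition sqdist a b := (a.1 - b.1) ^+ 2 + (a.2 - b.2) ^+ 2.

Lemma sqdist_unit_le a b : unit_vec a -> unit_vec b -> sqdist a b <= 4.
Proof.
rewrite /unit_vec /sqdist => ha hb.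
by have := sqr_ge0 (a.1 + b.1); have := sqr_ge0 (a.2 + b.2); nra.
Qed.

Lemma dir_sqdist a g : nsq a != 0 -> nsq g != 0 ->
  sqdist (dir a) (dir g) = 4 * (g.1 * a.2 - g.2 * a.1) ^+ 2 / (nsq a * nsq g).
Proof.
move=> a0 g0; rewrite /sqdist /dir (negPf a0) (negPf g0) /=.
by rewrite /nsq in a0 g0 *; field; rewrite a0 g0.
Qed.

Definition snd_diff a g b := (a.1 - 2 * g.1 + b.1) ^+ 2 + (a.2 - 2 * g.2 + b.2) ^+ 2.

(** The residual is the second difference plus [2 * delta * g]; the square of a sum is at most twice
    the sum of the squares. *)
Lemma dens_le_snd_diff delta a g b : unit_vec g ->
  dens delta a g b <= 2 * snd_diff a g b + 8 * delta ^+ 2.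
Proof.
rewrite /unit_vec => hg; rewrite /dens /snd_diff.
have -> : 8 * delta ^+ 2 = 8 * delta ^+ 2 * (g.1 ^+ 2 + g.2 ^+ 2) by rewrite hg mulr1.
have := sqr_ge0 (a.1 - 2 * g.1 + b.1 - 2 * delta * g.1).
have := sqr_ge0 (a.2 - 2 * g.2 + b.2 - 2 * delta * g.2).
move=> h1 h2; rewrite -subr_ge0.
rewrite (_ : _ - _ = (a.1 - 2 * g.1 + b.1 - 2 * delta * g.1) ^+ 2 +
  (a.2 - 2 * g.2 + b.2 - 2 * delta * g.2) ^+ 2); last by ring.
exact: addr_ge0.
Qed.

Lemma snd_diff_unit_le a g b : unit_vec a -> unit_vec g -> unit_vec b ->
  snd_diff a g b <= 16.
Proof.
move=> ha hg hb; have := sqdist_unit_le ha hg; have := sqdist_unit_le hb hg.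
rewrite /snd_diff /sqdist => h1 h2.
have := sqr_ge0 (a.1 - b.1); have := sqr_ge0 (a.2 - b.2); nra.
Qed.

(* With [c z] the cross product of [g] and [z], [dir a - dir g] is
   [2 i c(a) g a / (|g|^2 |a|^2)]. *)
Lemma snd_diff_dir a g b : nsq a != 0 -> nsq g != 0 -> nsq b != 0 ->
  let ca := g.1 * a.2 - g.2 * a.1 in let cb := g.1 * b.2 - g.2 * b.1 in
  snd_diff (dir a) (dir g) (dir b) =
  4 / nsq g * ((ca * (a.1 / nsq a) + cb * (b.1 / nsq b)) ^+ 2
              + (ca * (a.2 / nsq a) + cb * (b.2 / nsq b)) ^+ 2).
Proof.
move=> a0 g0 b0 ca cb.
have sub1 z : nsq z != 0 -> (dir z).1 - (dir g).1 =
    - 2 * (g.1 * z.2 - g.2 * z.1) * (g.1 * (z.2 / nsq z) + g.2 * (z.1 / nsq z)) / nsq g.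
  move=> z0; rewrite /dir (negPf z0) (negPf g0) /=.
  by rewrite /nsq in z0 g0 *; field; rewrite z0 g0.
have sub2 z : nsq z != 0 -> (dir z).2 - (dir g).2 =
    2 * (g.1 * z.2 - g.2 * z.1) * (g.1 * (z.1 / nsq z) - g.2 * (z.2 / nsq z)) / nsq g.
  move=> z0; rewrite /dir (negPf z0) (negPf g0) /=.
  by rewrite /nsq in z0 g0 *; field; rewrite z0 g0.
rewrite /snd_diff.
rewrite (_ : _ - _ + _ = ((dir a).1 - (dir g).1) + ((dir b).1 - (dir g).1)); last by ring.
rewrite (_ : (dir a).2 - _ + _ =
  ((dir a).2 - (dir g).2) + ((dir b).2 - (dir g).2)); last by ring.
rewrite !sub1// !sub2// -/ca -/cb.
move: (a.1 / nsq a) (a.2 / nsq a) (b.1 / nsq b) (b.2 / nsq b) => x1 x2 y1 y2.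
by rewrite /nsq in g0 *; field.
Qed.

(** The cross product is unchanged when [a] is replaced by [a - g]; then Lagrange's identity
    applies. *)
Lemma cross_sq_le g a : (g.1 * a.2 - g.2 * a.1) ^+ 2 <= nsq g * sqdist a g.
Proof.
rewrite /nsq /sqdist -subr_ge0.
rewrite (_ : _ - _ = (g.1 * (a.1 - g.1) + g.2 * (a.2 - g.2)) ^+ 2); first exact: sqr_ge0.
ring.
Qed.

Lemma nsq_far a g h : sqdist a g <= h -> 4 * h <= nsq g -> nsq g <= 4 * nsq a.
Proof.
rewrite /sqdist /nsq => ag hg.
have := sqr_ge0 (g.1 - 2 * (g.1 - a.1)); have := sqr_ge0 (g.2 - 2 * (g.2 - a.2)).
nra.
Qed.

(** [h] is a squared step length. Within a few steps of the zero the bound for unit vectors is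
    enough. Farther away, [ca * a / |a|^2 + cb * b / |b|^2] is split into [(ca + cb) * b / |b|^2],
    of second order by the last hypothesis, and [ca] times a difference of inverted points. *)
Lemma snd_diff_dir_le a g b h : 0 < h -> nsq g <= 1 ->
  sqdist a g <= h -> sqdist b g <= h -> snd_diff a g b <= h ^+ 2 ->
  snd_diff (dir a) (dir g) (dir b) <= 900 * h ^+ 2 / (h + nsq g) ^+ 2.
Proof.
move=> h0 g1 ag bg abg; have ng := nsq_ge0 g.
have hg0 : 0 < (h + nsq g) ^+ 2 by rewrite exprn_gt0// ltr_pwDl.
rewrite ler_pdivlMr//.
have [far|near] := leP (4 * h) (nsq g); last first.
  apply: (@le_trans _ _ (16 * (h + nsq g) ^+ 2)).
    rewrite ler_wpM2r ?(ltW hg0)//.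
    by apply: snd_diff_unit_le; exact: unit_vec_dir.
  by clear - near h0 ng; nra.
have na := nsq_far ag far; have nb := nsq_far bg far.
have ng0 : 0 < nsq g by lra.
have na0 : 0 < nsq a by lra.
have nb0 : 0 < nsq b by lra.
rewrite snd_diff_dir ?gt_eqF//=.
set ca := _ * a.2 - _; set cb := _ * b.2 - _.
have ca2 : ca ^+ 2 <= nsq g * h.
  by apply: le_trans (cross_sq_le g a) _; rewrite ler_wpM2l.
have cab : (ca + cb) ^+ 2 <= nsq g * h ^+ 2.
  apply: (@le_trans _ _ (nsq g * snd_diff a g b)); last by rewrite ler_wpM2l.
  rewrite /ca /cb /nsq /snd_diff -subr_ge0.
  rewrite (_ : _ - _ = (g.1 * (a.1 - 2 * g.1 + b.1) + g.2 * (a.2 - 2 * g.2 + b.2)) ^+ 2).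
    exact: sqr_ge0.
  by ring.
set W := _ ^+ 2 + _ ^+ 2.
(* The distance formula for the inversion [z / |z|^2]. *)
have dab : (a.1 / nsq a - b.1 / nsq b) ^+ 2 + (a.2 / nsq a - b.2 / nsq b) ^+ 2
    = sqdist a b / (nsq a * nsq b).
  have a0 : nsq a != 0 by rewrite gt_eqF.
  have b0 : nsq b != 0 by rewrite gt_eqF.
  by rewrite /sqdist /nsq in a0 b0 *; field; rewrite a0 b0.
have bb : (b.1 / nsq b) ^+ 2 + (b.2 / nsq b) ^+ 2 = (nsq b)^-1.
  have b0 : nsq b != 0 by rewrite gt_eqF.
  by rewrite /nsq in b0 *; field.
have ab4 : sqdist a b <= 4 * h.
  move: ag bg; rewrite /sqdist => ag bg.
  have := sqr_ge0 (a.1 - g.1 + (b.1 - g.1)); have := sqr_ge0 (a.2 - g.2 + (b.2 - g.2)).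
  by clear - ag bg; nra.
have W1 : W <= 2 * (ca + cb) ^+ 2 / nsq b
    + 2 * ca ^+ 2 * (sqdist a b / (nsq a * nsq b)).
  rewrite -bb -dab /W; clear.
  move: (a.1 / _) (a.2 / _) (b.1 / _) (b.2 / _) => x1 x2 y1 y2.
  rewrite -subr_ge0.
  rewrite (_ : _ - _ = ((ca + cb) * y1 - ca * (x1 - y1)) ^+ 2
     + ((ca + cb) * y2 - ca * (x2 - y2)) ^+ 2); last by ring.
  by rewrite addr_ge0 ?sqr_ge0.
have W2 : W <= 136 * h ^+ 2 / nsq g.
  apply: (le_trans W1).
  have e1 : 2 * (ca + cb) ^+ 2 / nsq b <= 8 * h ^+ 2.
    rewrite ler_pdivrMr//; clear - cab nb h0.
    have : nsq g * h ^+ 2 <= 4 * nsq b * h ^+ 2 by rewrite ler_wpM2r ?sqr_ge0.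
    by lra.
  have e2 : 2 * ca ^+ 2 * (sqdist a b / (nsq a * nsq b)) <= 128 * h ^+ 2 / nsq g.
    rewrite mulrA ler_pdivrMr ?mulr_gt0//.
    have s0 : 0 <= sqdist a b by rewrite addr_ge0 ?sqr_ge0.
    apply: (@le_trans _ _ (2 * (nsq g * h) * (4 * h))).
      by apply: ler_pM => //; [rewrite pmulr_rge0// sqr_ge0|rewrite ler_pM2l].
    rewrite [leRHS]mulrAC ler_pdivlMr//.
    have -> : 2 * (nsq g * h) * (4 * h) * nsq g = 8 * h ^+ 2 * (nsq g * nsq g) by ring.
    have -> : 128 * h ^+ 2 * (nsq a * nsq b) = 8 * h ^+ 2 * ((4 * nsq a) * (4 * nsq b)) by ring.
    by rewrite ler_wpM2l ?ler_pM// pmulr_rge0// sqr_ge0.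
  have e3 : 8 * h ^+ 2 <= 8 * h ^+ 2 / nsq g.
    have h8 : 0 <= 8 * h ^+ 2 by rewrite pmulr_rge0// sqr_ge0.
    by rewrite ler_peMr// invf_ge1.
  have -> : 136 * h ^+ 2 / nsq g = 8 * h ^+ 2 / nsq g + 128 * h ^+ 2 / nsq g.
    by rewrite -mulrDl -mulrDl; congr (_ * _ / _); ring.
  by apply: lerD => //; apply: le_trans e3.
apply: (@le_trans _ _ (4 / nsq g * (136 * h ^+ 2 / nsq g) * (h + nsq g) ^+ 2)).
  by rewrite ler_wpM2r ?(ltW hg0)// ler_wpM2l// divr_ge0.
have -> : 4 / nsq g * (136 * h ^+ 2 / nsq g) * (h + nsq g) ^+ 2 =
  544 * h ^+ 2 * ((h + nsq g) / nsq g) ^+ 2 by field; rewrite gt_eqF.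
have q : (h + nsq g) / nsq g <= 5 / 4.
  by rewrite ler_pdivrMr//; clear - far; lra.
have q0 : 0 <= (h + nsq g) / nsq g by rewrite divr_ge0// addr_ge0// ltW.
have q2 : ((h + nsq g) / nsq g) ^+ 2 <= 25 / 16 by clear - q q0; nra.
have h2 : 0 <= h ^+ 2 by rewrite sqr_ge0.
by clear - q2 h2; nra.
Qed.

End Vortex.

(** * Energy of the interpolation between the constant and the helix *)

Section VortexEnergy.
Variable R : realType.
Variables (r th : R) (P N : nat).
Hypothesis r0 : 0 < r.
Hypothesis r1 : r < 1.
Hypothesis th0 : 0 <= th.
Hypothesis thpi : th <= pi / 2.
Hypothesis cth : cos th = 1 - r ^+ 2.
Hypothesis thr : th <= 3 * r.
Hypothesis P0 : (0 < P)%N.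
Hypothesis rP1 : 1 <= P%:R * r.
Hypothesis rP2 : P%:R * r <= 2.
Hypothesis rN : 1 <= r * N%:R.

Let P0' : 0 < P%:R :> R. Proof. by rewrite ltr0n. Qed.
Variable h : R.
Hypothesis hE : h = 9 * r ^+ 2.
Let h0 : 0 < h. Proof. by rewrite hE mulr_gt0// exprn_gt0. Qed.

Let sin_sq_le (q : R) : 0 <= q -> sin q ^+ 2 <= q ^+ 2.
Proof.
move=> q0; have := sin_sub_le q0; rewrite sin0 !subr0 => sq.
by rewrite -[leLHS]real_normK ?num_real// ler_sqr ?nnegrE.
Qed.

Let th_ge : r <= th.
Proof.
have t : `|th| <= pi / 2 by rewrite ger0_norm.
have := one_sub_cos_le t; rewrite cth => h1; have h2 := sin_sq_le th0.
by rewrite -ler_sqr ?nnegrE ?(ltW r0)//; lra.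
Qed.

(** The segment from [(1, 0)] to the direction of angle [th * j / 2]. As [dir] doubles angles,
    column 0 becomes the constant and column [P] the helix of angle [th * j]. *)
Definition core (i j : nat) : R * R :=
  let t := i%:R / P%:R in let y := th * j%:R / 2 in
  (1 - t + t * cos y, t * sin y).

Definition vortex (i j : nat) : R * R :=
  if (i < P)%N then dir (core i j) else expi (th * (j + (i - P))%:R).

Let T (i : nat) : R := 1 - 2 * (i%:R / P%:R).
Let c (j : nat) : R := cos (th * j%:R / 4).

(** This locates the vortices: [T i] vanishes halfway along the segment, [c j] where its two ends
    are opposite. *)
Let nsq_coreE i j : nsq (core i j) = T i ^+ 2 + (1 - T i ^+ 2) * c j ^+ 2.
Proof.
have e : th * j%:R / 2 = th * j%:R / 4 + th * j%:R / 4 by field.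
have ce : cos (th * j%:R / 2) = 2 * c j ^+ 2 - 1.
  by rewrite e cosD -!expr2 sin2cos2 /c; ring.
rewrite /nsq /core /=; set t := _ / _.
transitivity ((1 - t) ^+ 2 + 2 * (1 - t) * t * cos (th * j%:R / 2)
    + t ^+ 2 * (cos (th * j%:R / 2) ^+ 2 + sin (th * j%:R / 2) ^+ 2)); first by ring.
by rewrite cos2Dsin2 ce /T -/t; ring.
Qed.

Let T2 i : (i <= P)%N -> T i ^+ 2 <= 1.
Proof.
move=> iP; have t0 : 0 <= i%:R / P%:R :> R by rewrite divr_ge0.
have t1 : i%:R / P%:R <= 1 :> R by rewrite ler_pdivrMr// mul1r ler_nat.
by rewrite /T; set t := _ / _ in t0 t1 *; nra.
Qed.

Let c2 j : c j ^+ 2 <= 1.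
Proof.
have := cos2Dsin2 (th * j%:R / 4); have := sqr_ge0 (sin (th * j%:R / 4)).
by rewrite /c; lra.
Qed.

Let nsq_core_le1 i j : (i <= P)%N -> nsq (core i j) <= 1.
Proof.
move=> /T2 t2; rewrite nsq_coreE; have := c2 j; have := sqr_ge0 (c j).
set x := T i ^+ 2 in t2 *; set y := c j ^+ 2; nra.
Qed.

(** Decouples columns and rows, so that the sum over the grid factorizes; it is an upper bound
    because [nsq (core i j)] dominates both [T i ^ 2] and [c j ^ 2]. *)
Let beta i j : R := h / (h + T i ^+ 2) * (h / (h + c j ^+ 2)).

Let beta_ge i j : (i <= P)%N ->
  900 * h ^+ 2 / (h + nsq (core i j)) ^+ 2 <= 900 * beta i j.
Proof.
move=> /T2 t2; rewrite /beta.
have t0 := sqr_ge0 (T i); have c0 := sqr_ge0 (c j); have c1 := c2 j.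
have e : nsq (core i j) = _ := nsq_coreE i j.
set x := T i ^+ 2 in t0 t2 e *; set y := c j ^+ 2 in c0 c1 e *.
have nx : x <= nsq (core i j) by rewrite e lerDl mulr_ge0// subr_ge0.
have ny : y <= nsq (core i j).
  have -> : nsq (core i j) = y + (1 - y) * x by rewrite e; ring.
  by rewrite lerDl mulr_ge0// subr_ge0.
have hp := h0.
have -> : 900 * (h / (h + x) * (h / (h + y))) = 900 * h ^+ 2 / ((h + x) * (h + y)).
  by field; apply/andP; split; rewrite gt_eqF// ltr_wpDr.
have h900 : 0 < 900 * h ^+ 2 by apply: mulr_gt0; [rewrite ltr0n|exact: exprn_gt0].
rewrite ler_pM2l// lef_pV2 ?posrE.
- by rewrite expr2 ler_pM ?lerD2l// addr_ge0// ltW.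
- by rewrite exprn_gt0// ltr_wpDr// (le_trans t0).
- by rewrite mulr_gt0// ltr_wpDr.
Qed.

Let invP : (P%:R)^-1 <= r :> R.
Proof. by rewrite -[leLHS]mul1r ler_pdivrMr// mulrC. Qed.

Let expi_sqdist x y : sqdist (expi x) (expi y) = 2 * (1 - cos (x - y)) :> R.
Proof.
have := cos2Dsin2 x; have := cos2Dsin2 y; rewrite cosB /sqdist /expi /= => hy hx.
transitivity (cos x ^+ 2 + sin x ^+ 2 + (cos y ^+ 2 + sin y ^+ 2)
  - 2 * (cos x * cos y + sin x * sin y)); first by ring.
by rewrite hx hy; ring.
Qed.

Let core_hor i j : sqdist (core i j) (core i.+1 j) <= h.
Proof.
have -> : sqdist (core i j) (core i.+1 j) =
   (P%:R)^-1 ^+ 2 * sqdist (expi 0) (expi (th * j%:R / 2)).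
  rewrite /sqdist /core /expi cos0 sin0 /=.
  by rewrite -[i.+1%:R]natr1; field; rewrite gt_eqF.
rewrite expi_sqdist.
have ip0 : 0 <= (P%:R)^-1 :> R by rewrite invr_ge0.
have : (P%:R)^-1 ^+ 2 <= r ^+ 2 by rewrite ler_sqr ?nnegrE ?(ltW r0)//; exact: invP.
have := cos_geN1 (0 - th * j%:R / 2); have := cos_le1 (0 - th * j%:R / 2).
have := sqr_ge0 (P%:R^-1 : R); rewrite hE.
set x := _ ^+ 2; set y := cos _; nra.
Qed.

Let core_ver i j : (i <= P)%N ->
  sqdist (core i j) (core i j.+1) <= h /\ sqdist (core i j.+2) (core i j.+1) <= h /\
  snd_diff (core i j) (core i j.+1) (core i j.+2) <= h ^+ 2.
Proof.
move=> iP; have t0 : 0 <= i%:R / P%:R :> R by rewrite divr_ge0.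
have t1 : i%:R / P%:R <= 1 :> R by rewrite ler_pdivrMr// mul1r ler_nat.
set y := th * j.+1%:R / 2.
have y1 : th * j%:R / 2 = y - th / 2 by rewrite /y -[j.+1%:R]natr1; field.
have y2 : th * j.+2%:R / 2 = y + th / 2.
  by rewrite /y (_ : j.+2%:R = j.+1%:R + 1 :> R) ?natr1//; field.
have hth : `|th / 2| <= pi / 2.
  by have a1 := thpi; have a2 := th0; rewrite ger0_norm; lra.
have g0 : 0 <= 1 - cos (th / 2) by rewrite subr_ge0 cos_le1.
have g1 : 1 - cos (th / 2) <= 9 / 4 * r ^+ 2.
  apply: (le_trans (one_sub_cos_le hth)).
  have t20 : 0 <= th / 2 by have := th0; lra.
  apply: (le_trans (sin_sq_le t20)).
  by have a1 := th0; have a2 := thr; have a3 := r0; nra.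
have sq k : sqdist (core i k) (core i j.+1) =
    (i%:R / P%:R) ^+ 2 * sqdist (expi (th * k%:R / 2)) (expi y).
  by rewrite /sqdist /core /expi/= -/y; ring.
have t2 : (i%:R / P%:R) ^+ 2 <= 1 :> R by rewrite expr_le1.
have tt0 : 0 <= (i%:R / P%:R) ^+ 2 :> R by rewrite sqr_ge0.
have r2 := sqr_ge0 r.
have bnd : (i%:R / P%:R) ^+ 2 * (2 * (1 - cos (th / 2))) <= h.
  by rewrite hE; set x := _ ^+ 2 in t2 tt0 *; set w := 1 - _ in g0 g1 *; nra.
split; [|split].
- rewrite sq expi_sqdist y1 (_ : y - th / 2 - y = - (th / 2)) ?cosN//; ring.
- rewrite sq expi_sqdist y2 (_ : y + th / 2 - y = th / 2)//; ring.
have -> : snd_diff (core i j) (core i j.+1) (core i j.+2) =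
   (i%:R / P%:R) ^+ 2 * (2 * (1 - cos (th / 2))) ^+ 2 * (cos y ^+ 2 + sin y ^+ 2).
  rewrite /snd_diff /core /= y1 y2 -/y !cosD !sinD cosN sinN; ring.
rewrite cos2Dsin2 mulr1.
apply: (@le_trans _ _ ((2 * (1 - cos (th / 2))) ^+ 2)).
  by rewrite ler_piMl ?sqr_ge0.
have w0 : 0 <= 2 * (1 - cos (th / 2)) by rewrite mulr_ge0.
rewrite ler_sqr ?nnegrE ?(ltW h0)//.
by rewrite hE; set w := 1 - _ in g0 g1 *; lra.
Qed.

Let vortexE i j : (i <= P)%N -> vortex i j = dir (core i j).
Proof.
rewrite leq_eqVlt => /predU1P[->|iP]; last by rewrite /vortex iP.
rewrite /vortex ltnn subnn addn0 /dir.
have n1 : nsq (core P j) = 1.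
  by rewrite nsq_coreE /T divff ?gt_eqF//; ring.
rewrite n1 oner_eq0 !divr1 /core/= divff ?gt_eqF// subrr add0r !mul1r /expi.
have e : th * j%:R = th * j%:R / 2 + th * j%:R / 2 by field.
rewrite {1 2}e cosD sinD; congr (_, _); ring.
Qed.

Let vortex_unit i j : unit_vec (vortex i j).
Proof.
by rewrite /vortex; case: ifP => _; [exact: unit_vec_dir|exact: unit_vec_expi].
Qed.

Lemma vortex_admissible : admissible vortex.
Proof.
split => // j; rewrite /vortex P0 /dir /core mul0r subr0 !mul0r addr0.
rewrite /nsq/= expr0n/= expr1n addr0 oner_eq0 subr0 mulr0 mul0r.
by rewrite divr1.
Qed.

Let dens_core a g b : sqdist a g <= h -> sqdist b g <= h ->
  snd_diff a g b <= h ^+ 2 -> nsq g <= 1 ->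
  dens (r ^+ 2) (dir a) (dir g) (dir b) <=
  2 * (900 * h ^+ 2 / (h + nsq g) ^+ 2) + 8 * r ^+ 4.
Proof.
move=> ag bg abg g1.
apply: le_trans (dens_le_snd_diff _ _ _ (unit_vec_dir g)) _.
have -> : 8 * (r ^+ 2) ^+ 2 = 8 * r ^+ 4 by ring.
by rewrite lerD2r ler_pM2l// snd_diff_dir_le.
Qed.

Let sqdist_sym (a b : R * R) : sqdist a b = sqdist b a.
Proof. by rewrite /sqdist; ring. Qed.

Let dens_hor_in i j : (i.+1 < P)%N ->
  dens (r ^+ 2) (vortex i j) (vortex i.+1 j) (vortex i.+2 j)
    <= 1800 * beta i.+1 j + 8 * r ^+ 4.
Proof.
move=> iP; rewrite !vortexE ?(ltnW iP)//; last by rewrite (leq_trans _ iP)// ltnW.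
apply: le_trans (dens_core _ _ _ _) _.
- exact: core_hor.
- by rewrite sqdist_sym; exact: core_hor.
- have -> : snd_diff (core i j) (core i.+1 j) (core i.+2 j) = 0.
    rewrite /snd_diff /core/= (_ : i.+2%:R = i%:R + 2 :> R); last by rewrite -natrD addn2.
    by rewrite (_ : i.+1%:R = i%:R + 1 :> R) ?natr1//; field; rewrite gt_eqF.
  by rewrite sqr_ge0.
- by apply: nsq_core_le1; exact: ltnW.
have := beta_ge j (ltnW iP); set B := 900 * h ^+ 2 / _; lra.
Qed.

Let dens_ver_in i j : (i < P)%N ->
  dens (r ^+ 2) (vortex i j) (vortex i j.+1) (vortex i j.+2)
    <= 1800 * beta i j.+1 + 8 * r ^+ 4.
Proof.
move=> /ltnW iP; rewrite !vortexE//; have [h1 [h2 h3]] := core_ver j iP.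
apply: le_trans (dens_core h1 h2 h3 (nsq_core_le1 _ iP)) _.
have := beta_ge j.+1 iP; set B := 900 * h ^+ 2 / _; lra.
Qed.

(** The triple across the junction with the helix. Order [r ^ 2] is affordable, as there is only one
    such triple per row. *)
Let dens_kink i j : (i.+1 = P)%N ->
  dens (r ^+ 2) (vortex i j) (vortex i.+1 j) (vortex i.+2 j) <= 600 * r ^+ 2.
Proof.
move=> iP; apply: le_trans (dens_le_snd_diff _ _ _ (vortex_unit _ _)) _.
have s1 : sqdist (vortex i j) (vortex i.+1 j) <= 16 * h.
  have [big|small] := leP 1 (4 * h).
    have := sqdist_unit_le (vortex_unit i j) (vortex_unit i.+1 j); lra.
  have iP' : (i.+1 <= P)%N by rewrite iP.
  rewrite !vortexE//; last exact: ltnW.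
  have n1 : nsq (core i.+1 j) = 1.
    by rewrite nsq_coreE /T iP divff ?gt_eqF//; ring.
  have n4 := @nsq_far _ (core i j) (core i.+1 j) h (core_hor i j).
  rewrite n1 in n4; have {}n4 := n4 (ltW small).
  have na : 0 < nsq (core i j) by lra.
  rewrite dir_sqdist ?gt_eqF ?n1// mulr1 ler_pdivrMr//.
  have := cross_sq_le (core i.+1 j) (core i j); rewrite n1 mul1r => cr.
  have hh := h0; have cc := core_hor i j.
  apply: (@le_trans _ _ (4 * h)); first by rewrite ler_pM2l// (le_trans cr).
  by nra.
have s2 : sqdist (vortex i.+2 j) (vortex i.+1 j) = 2 * r ^+ 2.
  rewrite /vortex iP ltnn ltnNge leqnSn/= expi_sqdist subnn subSn// subnn addn0.
  by rewrite -mulrBr addn1 -[j.+1%:R]natr1 addrAC subrr add0r mulr1 cth; ring.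
have s3 : snd_diff (vortex i j) (vortex i.+1 j) (vortex i.+2 j) <=
   2 * sqdist (vortex i j) (vortex i.+1 j) + 2 * sqdist (vortex i.+2 j) (vortex i.+1 j).
  rewrite /snd_diff /sqdist; move: (vortex i j) (vortex i.+1 j) (vortex i.+2 j) => a g b.
  rewrite -subr_ge0 (_ : _ - _ = (a.1 - b.1) ^+ 2 + (a.2 - b.2) ^+ 2); last by ring.
  by rewrite addr_ge0 ?sqr_ge0.
rewrite s2 in s3; rewrite hE in s1.
have r21 : r ^+ 2 <= 1 by rewrite expr_le1 ?ltW.
have : (r ^+ 2) ^+ 2 <= r ^+ 2 by rewrite expr2 ler_piMl ?sqr_ge0.
have := sqr_ge0 r; lra.
Qed.

Let dens_helix0 (n : nat) :
  dens (r ^+ 2) (expi (th * n%:R)) (expi (th * n.+1%:R)) (expi (th * n.+2%:R)) = 0.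
Proof.
have n2 : n.+2%:R = n%:R + 2 :> R by rewrite -natrD addn2.
have n1 : n.+1%:R = n%:R + 1 :> R by rewrite natr1.
by apply: (@dens_expi_helix _ r th _ _ _ false); rewrite // expr0 ?n2 n1; ring.
Qed.

Let dens_hor_out i j : (P <= i)%N ->
  dens (r ^+ 2) (vortex i j) (vortex i.+1 j) (vortex i.+2 j) = 0.
Proof.
move=> Pi; rewrite /vortex ltnNge Pi ltnNge (leqW Pi) ltnNge (leqW (leqW Pi))/=.
by rewrite !subSn ?(leqW Pi)// !addnS dens_helix0.
Qed.

Let dens_ver_out i j : (P <= i)%N ->
  dens (r ^+ 2) (vortex i j) (vortex i j.+1) (vortex i j.+2) = 0.
Proof.
by move=> Pi; rewrite /vortex ltnNge Pi/= !addSn dens_helix0.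
Qed.

Let A i : R := h / (h + T i ^+ 2).
Let B j : R := h / (h + c j ^+ 2).

Let A0 i : 0 <= A i. Proof. by rewrite divr_ge0 ?addr_ge0 ?sqr_ge0 ?ltW. Qed.
Let B0 j : 0 <= B j. Proof. by rewrite divr_ge0 ?addr_ge0 ?sqr_ge0 ?ltW. Qed.

(** [P * r <= 2] makes [T i ^ 2] at least [r ^ 2 * (i - P / 2) ^ 2]; with [h = 9 * r ^ 2] this gives
    9 times a Cauchy kernel. *)
Let sumA M : \sum_(0 <= i < M) A i <= 72.
Proof.
apply: (@le_trans _ _ (\sum_(0 <= i < M) 9 * (1 + (i%:R - P%:R / 2) ^+ 2)^-1)).
  apply: ler_sum => i _; rewrite /A.
  set X := (i%:R - P%:R / 2) ^+ 2.
  have X0 : 0 <= X by exact: sqr_ge0.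
  have -> : T i ^+ 2 = 4 * X / P%:R ^+ 2.
    by rewrite /T /X; field; rewrite gt_eqF.
  have hp := h0; have p2 : 0 < P%:R ^+ 2 :> R by rewrite exprn_gt0.
  have XP : h * X <= 36 * X / P%:R ^+ 2.
    rewrite ler_pdivlMr// hE.
    have : (P%:R * r) ^+ 2 <= 4 by have a1 := rP1; have a2 := rP2; nra.
    rewrite exprMn => rP; have : P%:R ^+ 2 * r ^+ 2 * X <= 4 * X by rewrite ler_wpM2r.
    lra.
  have q : 0 < h + 4 * X / P%:R ^+ 2 
    by apply: ltr_wpDr => //; apply: divr_ge0; [exact: mulr_ge0|exact: ltW].
  rewrite ler_pdivrMr// mulrAC ler_pdivlMr; last by rewrite ltr_wpDr.
  have -> : 9 * (h + 4 * X / P%:R ^+ 2) = 9 * h + 36 * X / P%:R ^+ 2 by ring.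
  lra.
rewrite -mulr_sumr; have := sum_cauchy_le M (P%:R / 2 : R); lra.
Qed.

Let cos_sq_pi (z : R) (k : nat) : cos (z + k%:R * pi) ^+ 2 = cos z ^+ 2.
Proof.
elim: k => [|k IH]; first by rewrite mul0r addr0.
by rewrite -[k.+1%:R]natr1 mulrDl mul1r addrA cosDpi sqrrN.
Qed.

Let K := Num.truncn (r * N%:R).
(** Heights of the vortices: the positive real zeros of [cos (th * y / 4)]. *)
Let x (k : nat) : R := (pi / 2 + k%:R * pi) * 4 / th.

(** [k] counts the half-periods below row [j], so that the phase is within [pi / 2] of the zero
    [x k], where the cosine is at least half the distance to it. *)
Let c_ge j : (j < N)%N -> exists2 k, (k < K.+1)%N &
  r ^+ 2 * (j%:R - x k) ^+ 2 / 64 <= c j ^+ 2.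
Proof.
move=> jN; have t0 : 0 < th := lt_le_trans r0 th_ge.
have p0 := pi_gt0 R; have p2 := pi_ge2 R.
pose z := th * j%:R / 4; have z0 : 0 <= z by rewrite /z divr_ge0 ?mulr_ge0.
pose k := Num.truncn (z / pi).
have /andP[k1 k2] : k%:R <= z / pi < k.+1%:R by apply: truncn_itv; rewrite divr_ge0// ltW.
rewrite ler_pdivlMr// in k1; rewrite ltr_pdivrMr// -[k.+1%:R]natr1 in k2.
exists k.
  rewrite ltnS /k /K le_truncn// ler_pdivrMr//.
  have jN' : j%:R <= N%:R :> R by rewrite ler_nat ltnW.
  have j0 : 0 <= j%:R :> R by [].
  have tj : th * j%:R <= 3 * r * N%:R by rewrite ler_pM.
  by rewrite /z; have := rN; nra.
pose s := z - k%:R * pi.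
have -> : c j ^+ 2 = sin (pi / 2 - s) ^+ 2.
  rewrite addrC sinDpihalf cosN /c -/z -(cos_sq_pi s k) /s.
  by congr (cos _ ^+ 2); ring.
have sp : `|pi / 2 - s| <= pi / 2.
  by rewrite ler_norml /s; apply/andP; split; lra.
have := abs_le_sin sp => qs.
have q2 : (pi / 2 - s) ^+ 2 <= 4 * sin (pi / 2 - s) ^+ 2.
  rewrite -[leLHS]real_normK ?num_real// -[sin _ ^+ 2]real_normK ?num_real//.
  by have := normr_ge0 (pi / 2 - s); set u := `|_| in qs *; set w := `|_| in qs *; nra.
have e : (pi / 2 - s) ^+ 2 = th ^+ 2 * (j%:R - x k) ^+ 2 / 16.
  by rewrite /s /z /x; field; rewrite gt_eqF.
have rt : r ^+ 2 * (j%:R - x k) ^+ 2 <= th ^+ 2 * (j%:R - x k) ^+ 2.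
  by rewrite ler_wpM2r ?sqr_ge0// ler_sqr ?nnegrE ?th_ge// ltW.
lra.
Qed.

(** Each row is charged to a vortex height, and each of the [K.+1 <= 2 * r * N] heights collects at
    most [576 * 8]. *)
Let sumB : \sum_(0 <= j < N) B j <= 576 * 16 * (r * N%:R).
Proof.
apply: (@le_trans _ _ (\sum_(0 <= j < N) \sum_(0 <= k < K.+1)
    576 * (1 + (j%:R - x k) ^+ 2)^-1)).
  rewrite !big_nat; apply: ler_sum => j /andP[_ jN].
  have [k kK ck] := c_ge jN.
  have p k' : 0 < 1 + (j%:R - x k') ^+ 2 by rewrite ltr_pwDl// sqr_ge0.
  apply: (@le_trans _ _ (576 * (1 + (j%:R - x k) ^+ 2)^-1)).
    rewrite /B; have hp := h0; have c0 := sqr_ge0 (c j).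
    have q : 0 < h + c j ^+ 2 by rewrite ltr_wpDr.
    rewrite ler_pdivrMr// mulrAC ler_pdivlMr// hE.
    have := sqr_ge0 r; set X := _ ^+ 2 in ck *; lra.
  rewrite (bigD1_seq k) ?mem_index_iota ?iota_uniq//= lerDl.
  by apply: sumr_ge0 => k' _; rewrite mulr_ge0 ?ler0n ?invr_ge0 ?(ltW (p _)).
rewrite exchange_big/=.
apply: (@le_trans _ _ (\sum_(0 <= k < K.+1) 576 * 8)).
  by apply: ler_sum => k _; rewrite -mulr_sumr ler_wpM2l ?ler0n ?sum_cauchy_le.
rewrite sumr_const_nat subn0 -[leLHS]mulr_natl -natr1.
have : K%:R <= r * N%:R.
  by have /andP[] := @truncn_itv _ (r * N%:R) (le_trans ler01 rN).
by have := rN; lra.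
Qed.

Let r34 : r ^+ 3 <= r /\ r ^+ 2 <= r.
Proof.
have r21 : r ^+ 2 <= 1 by rewrite expr_le1 ?ltW.
by split; [rewrite exprSr ler_piMl ?(ltW r0)|rewrite expr2 ler_piMl ?(ltW r0)// ltW].
Qed.

Let sum_if_le (M : nat) (F : nat -> R) : (forall i, 0 <= F i) ->
  \sum_(0 <= i < M) (if (i < P)%N then F i else 0) <= \sum_(0 <= i < P) F i.
Proof.
move=> F0.
apply: (@le_trans _ _ (\sum_(0 <= i < M + P) (if (i < P)%N then F i else 0))).
  apply: (@sum_nat_sub_le _ _ 0) => [i|]; [by case: ifP|exact: leq_addr].
rewrite (@big_cat_nat _ _ _ P)//= ?leq_addl// [X in _ + X]big1_seq.
  by rewrite addr0 !big_nat le_eqVlt; apply/orP; left; apply/eqP;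
    apply: eq_bigr => i /andP[_ ->].
by move=> i /andP[_]; rewrite mem_index_iota => /andP[Pi _]; rewrite ltnNge Pi.
Qed.

Variable X : R.
Hypothesis XE : X = 1800 * 72 * (576 * 16).

(** The factorized sum contributes [X * r * N] in each direction. The terms [8 * r ^ 4], summed over
    [P] columns, and the junction are of order [r] per row; the helix is free. *)
Lemma vortex_energy :
  grid_energy N (r ^+ 2) vortex <= (2 * X + 700) * (r * N%:R).
Proof.
have [r3 r2] := r34.
have r4 : 0 <= 8 * r ^+ 4 by rewrite pmulr_rge0// exprn_ge0// ltW.
have b0 i j : 0 <= 1800 * beta i j.
  by apply: mulr_ge0; [exact: ler0n|apply: mulr_ge0; [exact: A0|exact: B0]].
have Pr4 : P%:R * (8 * r ^+ 4) <= 16 * r.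
  have -> : P%:R * (8 * r ^+ 4) = 8 * (P%:R * r) * r ^+ 3 by ring.
  have := rP2; have := rP1; have : 0 <= r ^+ 3 by rewrite exprn_ge0// ltW.
  by set y := P%:R * r; nra.
have sA : \sum_(0 <= i < P) A i.+1 <= 72.
  by apply: le_trans (sumA (1 + P)); exact: (@sum_nat_sub_le _ A 1 P (1 + P) A0 (leqnn _)).
have sB : \sum_(0 <= j < N.-2) B j.+1 <= 576 * 16 * (r * N%:R).
  apply: le_trans sumB; case: (ltnP N 2) => N2.
    by rewrite big_geq ?sumr_ge0//; case: (N) N2 => [|[|]].
  by apply: (@sum_nat_sub_le _ B 1 N.-2 N B0); case: (N) N2 => [|[|n]].
have bs : \sum_(0 <= i < P) (8 * r ^+ 4) <= 16 * r.
  by rewrite sumr_const_nat subn0 -[leLHS]mulr_natl.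
have hor j : \sum_(0 <= i < N.-2)
     dens (r ^+ 2) (vortex i j) (vortex i.+1 j) (vortex i.+2 j)
   <= 1800 * 72 * B j + 616 * r.
  pose F i : R := 1800 * beta i.+1 j + 8 * r ^+ 4 + (if i.+1 == P then 600 * r ^+ 2 else 0).
  have F0 i : 0 <= F i.
    rewrite /F; apply: addr_ge0; first by rewrite addr_ge0 ?b0.
    case: ifP => _; last exact: lexx.
    by apply: mulr_ge0; [exact: ler0n|exact: sqr_ge0].
  apply: le_trans (le_trans (@sum_if_le N.-2 F F0) _).
    apply: ler_sum => i _; case: ltnP => iP; last by rewrite dens_hor_out.
    have [e|ne] := eqVneq i.+1 P.
      rewrite /F e eqxx -{1 2}e; apply: le_trans (dens_kink _ e) _.
      by rewrite lerDr addr_ge0 ?b0.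
    rewrite /F (negPf ne) addr0; apply: dens_hor_in.
    by rewrite ltn_neqAle ne.
  rewrite /F !big_split/= -mulr_sumr.
  have -> : \sum_(0 <= i < P) beta i.+1 j = (\sum_(0 <= i < P) A i.+1) * B j.
    by rewrite mulr_suml.
  have -> : \sum_(0 <= i < P) (if i.+1 == P then 600 * r ^+ 2 else 0) = 600 * r ^+ 2.
    rewrite -{1}(prednK P0) big_nat_recr//= prednK// eqxx big1_seq ?add0r// => i.
    move=> /andP[_]; rewrite mem_index_iota => /andP[_ iP].
    by rewrite ltn_eqF// -[ltnRHS](prednK P0) ltnS.
  have : (\sum_(0 <= i < P) A i.+1) * B j <= 72 * B j by rewrite ler_wpM2r.
  by move: bs r2; lra.
have ver : \sum_(0 <= i < N) \sum_(0 <= j < N.-2)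
     dens (r ^+ 2) (vortex i j) (vortex i j.+1) (vortex i j.+2)
   <= X * (r * N%:R) + 16 * (r * N%:R).
  pose F i : R := \sum_(0 <= j < N.-2) (1800 * beta i j.+1 + 8 * r ^+ 4).
  have F0 i : 0 <= F i by apply: sumr_ge0 => j _; rewrite addr_ge0 ?b0.
  apply: le_trans (le_trans (@sum_if_le N F F0) _).
    apply: ler_sum => i _; case: ltnP => iP.
      by apply: ler_sum => j _; exact: dens_ver_in.
    by rewrite big1// => j _; exact: dens_ver_out.
  have -> : \sum_(0 <= i < P) F i = 1800 * ((\sum_(0 <= i < P) A i) *
      (\sum_(0 <= j < N.-2) B j.+1)) + N.-2%:R * (P%:R * (8 * r ^+ 4)).
    rewrite mulr_suml mulr_sumr.
    have -> : N.-2%:R * (P%:R * (8 * r ^+ 4)) = \sum_(0 <= i < P) N.-2%:R * (8 * r ^+ 4).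
      by rewrite sumr_const_nat subn0 -[RHS]mulr_natl; ring.
    rewrite -big_split/=; apply: eq_bigr => i _; rewrite /F big_split/=.
    rewrite sumr_const_nat subn0; congr (_ + _); last by rewrite -[LHS]mulr_natl.
    by rewrite !mulr_sumr; apply: eq_bigr => j _.
  have N2 : N.-2%:R <= N%:R :> R by rewrite ler_nat; case: (N) => [|[|n]]//=; rewrite leqW// leqW.
  have AB : (\sum_(0 <= i < P) A i) * (\sum_(0 <= j < N.-2) B j.+1)
      <= 72 * (576 * 16 * (r * N%:R)).
    by apply: ler_pM; [exact: sumr_ge0|exact: sumr_ge0|exact: sumA|exact: sB].
  have NP : N.-2%:R * (P%:R * (8 * r ^+ 4)) <= N%:R * (16 * r).
    by apply: ler_pM; [exact: ler0n|rewrite mulr_ge0|exact: N2|exact: Pr4].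
  apply: le_trans (lerD (ler_wpM2l (ler0n R 1800) AB) NP) _.
  by rewrite XE le_eqVlt; apply/orP; left; apply/eqP; ring.
have horS : \sum_(0 <= j < N) \sum_(0 <= i < N.-2)
     dens (r ^+ 2) (vortex i j) (vortex i.+1 j) (vortex i.+2 j)
   <= X * (r * N%:R) + 616 * (r * N%:R).
  apply: (@le_trans _ _ (\sum_(0 <= j < N) (1800 * 72 * B j + 616 * r))).
    by apply: ler_sum => j _; exact: hor.
  rewrite big_split/= -mulr_sumr sumr_const_nat subn0 -[X in _ + X <= _]mulr_natl.
  apply: lerD; last by rewrite le_eqVlt; apply/orP; left; apply/eqP; ring.
  rewrite XE -[leRHS]mulrA; apply: ler_wpM2l; last exact: sumB.
  by apply: mulr_ge0; exact: ler0n.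
have rN0 : 0 <= r * N%:R := le_trans ler01 rN.
apply: le_trans (lerD horS ver) _; lra.
Qed.

End VortexEnergy.

(** * Conclusion *)

Lemma upper_vortex (R : realType) : exists2 C : R, 0 < C &
  forall (eps r : R) (N : nat), 0 < eps < r -> r < 1 ->
    1 <= N%:R * eps -> N%:R * eps <= 3 / 2 ->
    exists2 v, admissible v &
      eps ^+ 2 / 2 * grid_energy N (r ^+ 2) v <= C * (eps * r).
Proof.
have [X XE] : exists X : R, X = 1800 * 72 * (576 * 16) by exists (1800 * 72 * (576 * 16)).
have X0 : 0 <= X.
  by rewrite XE; apply: mulr_ge0; apply: mulr_ge0; exact: ler0n.
have C0 : 0 < 2 * X + 700.
  by apply: ltr_wpDl; [exact: mulr_ge0|rewrite ltr0n].
exists (2 * X + 700) => // eps r N /andP[e0 er] r1 Ne1 Ne.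
have r0 : 0 < r := lt_trans e0 er.
have hr : 0 < r < 1 by rewrite r0.
have [th [/andP[th0 thpi] cth thr]] := helix_angle hr.
have [P [P0 rP1 rP2 _]] := transition_width hr.
have rN : 1 <= r * N%:R.
  by apply: (le_trans Ne1); rewrite mulrC ler_wpM2r// ltW.
exists (vortex th P); first exact: vortex_admissible.
have e2 : 0 <= eps ^+ 2 / 2 by rewrite divr_ge0// sqr_ge0.
have VE := vortex_energy r0 r1 th0 thpi cth thr P0 rP1 rP2 rN erefl XE.
apply: le_trans (ler_wpM2l e2 VE) _.
have -> : eps ^+ 2 / 2 * ((2 * X + 700) * (r * N%:R)) =
  (2 * X + 700) * (eps * r * ((N%:R * eps) / 2)) by field.
rewrite ler_wpM2l ?(ltW C0)// ler_piMr ?mulr_ge0 ?(ltW e0) ?(ltW r0)//.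
by clear - Ne; lra.
Qed.

(** Each entry of the minimum [s] is matched by one competitor. The last two need [eps < r];
    otherwise [delta ^ 2 = r ^ 4] is already at most both other entries and the constant field
    serves. *)
Lemma min_energy_upper (R : realType) : exists2 C : R, 0 < C &
  forall eps delta : R, 0 < eps < 1 / 2 -> 0 < delta < 1 ->
    exists m : R, is_min_energy eps delta m /\ m <= C * s eps delta.
Proof.
have [C2 C20 up2] := upper_vortex R.
have [C1 C1E] : exists C1 : R, C1 = 120 * 58 by exists (120 * 58).
have C10 : 0 < C1 by rewrite C1E; apply: mulr_gt0; rewrite ltr0n.
exists (9 + C1 + C2) => [|eps delta he /andP[d0 d1]].
  by apply: addr_gt0 => //; apply: addr_gt0.
have /andP[e0 e2] := he.
have [N [NP N2 Ne1 Ne]] := grid_size he.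
have [v va [vm vmin]] := min_energy_grid delta e0 N2 NP.
exists (eps ^+ 2 / 2 * grid_energy N delta v); split => //.
have ee : 0 <= eps ^+ 2 / 2 by rewrite divr_ge0// sqr_ge0.
set m := eps ^+ 2 / 2 * grid_energy N delta v.
have below w : admissible w -> m <= eps ^+ 2 / 2 * grid_energy N delta w.
  by move=> wa; rewrite ler_wpM2l//; exact: vmin.
have [r r0 dr] := sqrt_exists d0.
have r1 : r < 1.
  by rewrite ltNge; apply/negP => big; clear - d1 dr big; nra.
have half : delta `^ (1 / 2) = r by rewrite dr (powR_sqr_half 1 r0) expr1.
have logE := log_scalingE eps r0; rewrite -dr in logE.
have m0 : m <= 9 * delta ^+ 2.
  by have [w wa h] := upper_const delta e0 Ne; apply: le_trans (below _ wa) h.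
have mC a K : K <= 9 + C1 + C2 -> 0 <= a -> m <= K * a -> m <= (9 + C1 + C2) * a.
  by move=> KC a0 h; apply: (le_trans h); rewrite ler_wpM2r.
have K9 : 9 <= 9 + C1 + C2 by clear - C10 C20; lra.
have K1 : C1 <= 9 + C1 + C2 by clear - C10 C20; lra.
have K2 : C2 <= 9 + C1 + C2 by clear - C10 C20; lra.
have log0 : 0 <= log_scaling eps delta.
  by rewrite logE mulr_ge0 ?addr_ge0// mulr_ge0 ?exprn_ge0 ?ltW.
have er0 : 0 <= eps * r by rewrite mulr_ge0 ?ltW.
have md : m <= (9 + C1 + C2) * delta ^+ 2.
  by apply: (mC _ 9) => //; exact: sqr_ge0.
have ml : m <= (9 + C1 + C2) * log_scaling eps delta.
  have [re|er] := leP r eps.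
    apply: (mC _ 9) => //; apply: (le_trans m0); rewrite ler_wpM2l// logE.
    have -> : delta ^+ 2 = r * r ^+ 3 by rewrite dr; ring.
    apply: (@le_trans _ _ (eps * r ^+ 3)).
      by rewrite ler_wpM2r// exprn_ge0// ltW.
    by rewrite ler_peMr ?lerDr// mulr_ge0 ?exprn_ge0 ?(ltW e0) ?(ltW r0).
  have er' : 0 < eps < r by rewrite e0.
  have [w wa] := upper_log er' r1 Ne1 Ne; rewrite -dr -C1E => h.
  by apply: (mC _ C1) => //; exact: le_trans (below _ wa) h.
have mh : m <= (9 + C1 + C2) * (eps * r).
  have [re|er] := leP r eps.
    apply: (mC _ 9) => //; apply: (le_trans m0); rewrite ler_wpM2l//.
    have -> : delta ^+ 2 = r * r * delta by rewrite dr; ring.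
    apply: (@le_trans _ _ (r * r)); first by rewrite ler_piMr ?mulr_ge0 ?(ltW r0) ?(ltW d1).
    by rewrite ler_wpM2r// ltW.
  have er' : 0 < eps < r by rewrite e0.
  have [w wa] := up2 eps r N er' r1 Ne1 Ne; rewrite -dr => h.
  by apply: (mC _ C2) => //; exact: le_trans (below _ wa) h.
by rewrite /s half !minEle; case: ifP => // _; case: ifP.
Qed.

Theorem theorem2p5 (R : realType) :
  (exists C : R, 0 < C /\
     forall eps delta : R, 0 < eps < 1 / 2 -> 0 < delta < 1 ->
       exists m : R, is_min_energy eps delta m /\ m <= C * s eps delta)
  /\
  (exists delta_bar : R, 0 < delta_bar < 1 /\
     exists c : R, 0 < c /\
       (forall eps delta : R, 0 < eps < 1 / 2 -> delta_bar <= delta < 1 ->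
          exists m : R, is_min_energy eps delta m /\
            c * (eps * delta `^ (1 / 2)) <= m) /\
       (forall eps delta : R, 0 < delta < delta_bar -> delta <= eps < 1 / 2 ->
          exists m : R, is_min_energy eps delta m /\
            c * Num.min (delta ^+ 2) (log_scaling eps delta) <= m)).
Proof.
split; first by have [C C0 up] := min_energy_upper R; exists C.
(* The threshold up to which [dens_dotv] aligns the triples of a cheap field. *)
exists (1 / 400); split; first by apply/andP; split; lra.
have [c [c0 c1]] : exists c : R, 0 < c /\ c * 1000 <= 1 / 1000.
  exists (1 / 1000 / 1000); split.
    by rewrite mul1r divr_gt0 ?invr_gt0 ?ltr0n.
  by rewrite mulrVK// unitfE pnatr_eq0.
exists (c / 4); split; first by rewrite divr_gt0.
split => [eps delta he hd|eps delta hd he]; last first.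
  exact: min_energy_lower_small.
have [m [mm h]] := min_energy_lower_large c0 c1 he hd.
exists m; split => //; apply: le_trans h; have /andP[e0 _] := he.
by rewrite ler_wpM2r ?mulr_ge0 ?powR_ge0 ?(ltW e0)//; clear - c0; lra.
Qed.
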